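(* Let $m\geq 1$ be an integer and let $$I_{k,n}^{(m)}=\left\{(r,\mathbf{a})=(r,a_2,\ldots,a_n)\in\mathbb{Z}^{n}:\ (m-1)(k-1)\leq a_i\leq m(k-1)\text{ for all }2\leq i\leq n,\text{ and }0\leq r\leq |\mathbf{a}|-2m\right\}.$$ Then the collection $$\mathcal{B}_{k,n}^{(m)}=\left\{\theta_{r,\mathbf{a}}^{(m)}=\frac{x^r\,dx^{\otimes m}}{y_2^{a_2}y_3^{a_3}\cdots y_n^{a_n}}:\ (r,\mathbf{a})\in I_{k,n}^{(m)}\right\}$$ is a $K$-basis of $V_m=H^0\left(F_{k,n},\Omega_{F_{k,n}}^{\otimes m}\right)$.
   Context: $K$ is an algebraically closed field of characteristic $p\geq 0$, and $k,n\geq 2$ are integers with $(k-1)(n-1)>1$ and $p\nmid k$ (no condition on $k$ when $p=0$). Fix $\lambda_1=1$ and pairwise distinct $\lambda_2,\ldots,\lambda_{n-1}\in K\setminus\{0,1\}$. The generalized Fermat curve $F_{k,n}$ of type $(k,n)$ is the smooth projective curve in $\mathbb{P}^n_K$ (homogeneous coordinates $X_0,\ldots,X_n$) defined by $$\lambda_iX_0^k+X_1^k+X_{i+1}^k=0,\qquad 1\leq i\leq n-1.$$ Set $x=X_1/X_0$ and $y_i=X_i/X_0$ for $2\leq i\leq n$, viewed as rational functions on $F_{k,n}$; thus $\lambda_i+x^k+y_{i+1}^k=0$ for $1\leq i\leq n-1$. $\Omega_{F_{k,n}}$ denotes the canonical sheaf (sheaf of regular 1-differentials). For $\mathbf{a}=(a_2,\ldots,a_n)\in\mathbb{Z}^{n-1}$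 write $|\mathbf{a}|=\sum_{i=2}^n a_i$. For $(r,\mathbf{a})\in\mathbb{Z}^n$, $\theta^{(m)}_{r,\mathbf{a}}$ is a priori a meromorphic $m$-differential on $F_{k,n}$. *)

(* Defs.v *)
From HB Require Import structures.
From mathcomp Require Export all_boot all_order all_algebra.
From mathcomp Require Export mpoly.

Set Implicit Arguments.
Unset Strict Implicit.
Unset Printing Implicit Defensive.

Import GRing.Theory Num.Theory.
Local Open Scope ring_scope.

(* A point of P^n is given by homogeneous coordinates P : 'I_n.+1 -> K, not   *)
(* all zero; a projective variety is a predicate X on such coordinate vectors *)
(* that is stable under scaling.                                              *)

Definition fermat_curve (K : fieldType) (k n : nat) (lam : nat -> K)
    (P : 'I_n.+1 -> K) : Prop :=
  (exists i, P i != 0) /\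
  (forall i : nat, (1 <= i <= n - 1)%N ->
     lam i * P (inord 0) ^+ k + P (inord 1) ^+ k + P (inord i.+1) ^+ k = 0).

(* L is the function field of the irreducible variety X in P^n, X not inside  *)
(* the hyperplane X_0 = 0, and xi i is the rational function X_i / X_0.  For  *)
(* a form G of degree e, mmap iota xi G is G / X_0^e; it must be zero exactly *)
(* when G vanishes on X, and L must be the set of quotients G / H of forms of *)
(* equal degree with H not identically zero on X.  These conditions determine *)
(* (L, iota, xi) up to a unique isomorphism.                                  *)
Definition is_function_field (K L : fieldType) (n : nat)
    (X : ('I_n.+1 -> K) -> Prop) (iota : {rmorphism K -> L})
    (xi : 'I_n.+1 -> L) : Prop :=
  [/\ xi ord0 = 1,
      forall (e : nat) (G : {mpoly K[n.+1]}), G \is e.-homog ->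
        (mmap iota xi G = 0 <-> forall P, X P -> G.@[P] = 0)
    & forall f : L, exists (e : nat) (G H : {mpoly K[n.+1]}),
        [/\ G \is e.-homog, H \is e.-homog, mmap iota xi H != 0
          & f = mmap iota xi G / mmap iota xi H]].

(* f belongs to the local ring O_{X,P}, as a subring of the function field.   *)
Definition regular_at (K L : fieldType) (n : nat) (iota : {rmorphism K -> L})
    (xi : 'I_n.+1 -> L) (P : 'I_n.+1 -> K) (f : L) : Prop :=
  exists (e : nat) (G H : {mpoly K[n.+1]}),
    [/\ G \is e.-homog, H \is e.-homog, H.@[P] != 0
      & f = mmap iota xi G / mmap iota xi H].

Definition is_derivation (K L : fieldType) (iota : {rmorphism K -> L})
    (M : lmodType L) (D : L -> M) : Prop :=
  [/\ forall c : K, D (iota c) = 0,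
      forall f g : L, D (f + g) = D f + D g
    & forall f g : L, D (f * g) = f *: D g + g *: D f].

(* (Omega, d) is the module of Kaehler differentials of L over K, i.e. the    *)
(* module of meromorphic differentials, given by its universal property.      *)
Definition is_kaehler (K L : fieldType) (iota : {rmorphism K -> L})
    (Omega : lmodType L) (d : L -> Omega) : Prop :=
  is_derivation iota d /\
  forall (M : lmodType L) (D : L -> M), is_derivation iota D ->
    (exists phi : {linear Omega -> M}, forall f, phi (d f) = D f) /\
    (forall phi psi : {linear Omega -> M},
       (forall f, phi (d f) = psi (d f)) -> phi =1 psi).

Definition upd (I : finType) (V : Type) (w : {ffun I -> V}) (i : I) (v : V) :
    {ffun I -> V} :=
  [ffun j => if j == i then v else w j].

Definition multilinear (L : fieldType) (m : nat) (V M : lmodType L)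
    (g : {ffun 'I_m -> V} -> M) : Prop :=
  forall (w : {ffun 'I_m -> V}) (i : 'I_m) (c : L) (u v : V),
    g (upd w i (c *: u + v)) = c *: g (upd w i u) + g (upd w i v).

(* (T, tens) is the m-th tensor power of V over L:                            *)
(* tens w = w 0 (x) w 1 (x) ... (x) w (m-1).                                  *)
Definition is_tensor_power (L : fieldType) (m : nat) (V T : lmodType L)
    (tens : {ffun 'I_m -> V} -> T) : Prop :=
  multilinear tens /\
  forall (M : lmodType L) (g : {ffun 'I_m -> V} -> M), multilinear g ->
    (exists phi : {linear T -> M}, forall w, phi (tens w) = g w) /\
    (forall phi psi : {linear T -> M},
       (forall w, phi (tens w) = psi (tens w)) -> phi =1 psi).

(* The stalk at P of the m-th tensor power of the canonical sheaf, inside the *)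
(* meromorphic m-differentials: the O_{X,P}-span of df_1 (x) ... (x) df_m     *)
(* with all f_i in O_{X,P}.                                                   *)
Definition mdiff_regular_at (K L : fieldType) (n m : nat)
    (iota : {rmorphism K -> L}) (xi : 'I_n.+1 -> L)
    (Omega : lmodType L) (d : L -> Omega)
    (T : lmodType L) (tens : {ffun 'I_m -> Omega} -> T)
    (P : 'I_n.+1 -> K) (w : T) : Prop :=
  exists (N : nat) (g : 'I_N -> L) (f : 'I_N -> 'I_m -> L),
    [/\ forall s, regular_at iota xi P (g s),
        forall s i, regular_at iota xi P (f s i)
      & w = \sum_(s < N) g s *: tens [ffun i => d (f s i)]].

(* H^0(X, Omega_X^{(x) m}) for a smooth curve X: a section of this invertible *)
(* sheaf is a meromorphic m-differential lying in the stalk at every point.   *)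
Definition global_mdiff (K L : fieldType) (n m : nat)
    (X : ('I_n.+1 -> K) -> Prop) (iota : {rmorphism K -> L})
    (xi : 'I_n.+1 -> L) (Omega : lmodType L) (d : L -> Omega)
    (T : lmodType L) (tens : {ffun 'I_m -> Omega} -> T) (w : T) : Prop :=
  forall P, X P -> mdiff_regular_at iota xi d tens P w.

(* The family (v j), j in A, is a K-basis of the K-subspace V of T, where K   *)
(* acts on T through iota.  Indices j may not be repeated, so that freeness   *)
(* includes the injectivity of v on A.                                        *)
Definition is_Kbasis (K L : fieldType) (iota : {rmorphism K -> L})
    (T : lmodType L) (V : T -> Prop) (J : eqType) (A : pred J) (v : J -> T) :
    Prop :=
  (forall (s : seq J) (c : J -> K), uniq s -> all A s ->
     \sum_(j <- s) iota (c j) *: v j = 0 -> forall j, j \in s -> c j = 0) /\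
  (forall w : T, V w <->
     exists (s : seq J) (c : J -> K),
       [/\ uniq s, all A s & w = \sum_(j <- s) iota (c j) *: v j]).

(* An index (r, a_2, ..., a_n) in Z^n is a pair (r, a), a j standing for      *)
(* a_{j+2}; correspondingly xi (inord j.+2) is y_{j+2}.                       *)

Definition index_set (k n m : nat) (ra : int * {ffun 'I_n.-1 -> int}) : bool :=
  let: (r, a) := ra in
  [forall j, (m%:Z - 1) * (k%:Z - 1) <= a j <= m%:Z * (k%:Z - 1)] &&
  (0 <= r <= \sum_j a j - 2%:Z * m%:Z).

Definition theta (L : fieldType) (n m : nat) (xi : 'I_n.+1 -> L)
    (Omega : lmodType L) (d : L -> Omega)
    (T : lmodType L) (tens : {ffun 'I_m -> Omega} -> T)
    (ra : int * {ffun 'I_n.-1 -> int}) : T :=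
  let: (r, a) := ra in
  let x := xi (inord 1) in
  (x ^ r / \prod_(j < n.-1) xi (inord j.+2) ^ a j) *: tens [ffun => d x].

(* Main.v *)
From HB Require Import structures.
Require Import Defs.
From mathcomp Require Import all_boot all_order all_algebra.
From mathcomp Require Import mpoly.
From mathcomp Require Import separable cyclic cyclotomic.
From mathcomp Require Import zify ring.

Set Implicit Arguments.
Unset Strict Implicit.
Unset Printing Implicit Defensive.

Import GRing.Theory Num.Theory.
Local Open Scope ring_scope.

(** Let x, y_2, ..., y_n be the affine coordinate functions, let y be the
    product of the y_i, and write a meromorphic m-differential as h dx^m, where
    h is a rational function.

    The curve is a Galois covering of the x-line with group mu_k^(n-1), which
    multiplies the y_i by k-th roots of unity.  The monomials y^b with all
    exponents in [0, k) are eigenvectors for distinct characters, hence are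
    linearly independent over K(x); the norm of a denominator lies in K(x), so
    they also span the function field over K(x).  Therefore
    h y^(m(k-1)) = sum_b r_b(x) y^b with r_b in K(x) ([ymon_free],
    [function_decomposition]), and the basis of the theorem consists of the
    h dx^m with one nonzero r_b, equal to a power of x, where
    a_i = m(k-1) - b_i.  It remains to find out when such a sum is regular.

    The stalks are computed in [stalk_affine] and [stalk_infinity].  At an
    affine point where no y_i vanishes, x is a local parameter.  At an affine
    point where y_j vanishes, y_j is one, the other y_i are units, and dx is a
    unit times y_j^(k-1) dy_j.  In both cases h dx^m is regular if and only if
    h y^(m(k-1)) is.  At a point at infinity 1/x is a local parameter and
    h dx^m is regular if and only if h x^(2m) is.

    The Galois group permutes the affine points and the points at infinity, so
    if h satisfies these conditions then each of its isotypic components does.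
    A component r_b(x) y^b which is regular at all affine points has polynomial
    r_b: over a pole x_0 of r_b, the function (x - x_0)/y^b vanishes at every
    point of the fibre, because x - x_0 is either a local parameter where y^b
    is a unit, or a unit times y_j^k while the exponent b_j is less than k
    ([x_shift_vanishes], [component_polynomial]).  At infinity each y_i / x is a
    unit, and the remaining condition is the bound r <= |a| - 2m on the degree
    ([term_at_infinity]).

    All local arguments use only the evaluation of regular functions at a
    point, never valuations.  That dx is nonzero needs a derivation of the
    function field with value 1 at x: it comes from the tangent vector field on
    forms, and it passes to the quotient because forms and their derivatives
    have simultaneous normal forms in the y^b ([normal_pair_form]). *)

(** * Values of rational functions at points *)

Section Values.
Variables (K L : fieldType) (n : nat) (X : ('I_n.+1 -> K) -> Prop).
Variables (iota : {rmorphism K -> L}) (xi : 'I_n.+1 -> L).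
Hypothesis hL : is_function_field X iota xi.

(** Evaluation at P as a relation: with the value kept next to the function,
    a regular function that vanishes at P, or a unit, can be recognized without
    a valuation. *)
Definition has_value (P : 'I_n.+1 -> K) (f : L) (c : K) : Prop :=
  exists (e : nat) (G H : {mpoly K[n.+1]}),
    [/\ G \is e.-homog, H \is e.-homog, H.@[P] != 0,
        f = mmap iota xi G / mmap iota xi H & c = G.@[P] / H.@[P]].

Lemma regular_atP P f :
  regular_at iota xi P f <-> exists c, has_value P f c.
Proof.
split=> [[e [G [H [hG hH HP ->]]]]|[c [e [G [H [hG hH HP -> _]]]]]].
  by exists (G.@[P] / H.@[P]), e, G, H.
by exists e, G, H.
Qed.

Lemma has_value_regular P f c : has_value P f c -> regular_at iota xi P f.
Proof. by move=> h; apply/regular_atP; exists c. Qed.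

Lemma homog_mvar i : ('X_i : {mpoly K[n.+1]}) \is 1.-homog.
Proof. by rewrite dhomogX /= mdeg1. Qed.

Lemma homog_mconst c : (c%:MP : {mpoly K[n.+1]}) \is 0.-homog.
Proof. by rewrite -[c%:MP]mulr1 mul_mpolyC rpredZ ?dhomog1. Qed.

Section AtPoint.
Variable P : 'I_n.+1 -> K.
Hypothesis XP : X P.

Lemma form_neq0 e (H : {mpoly K[n.+1]}) :
  H \is e.-homog -> H.@[P] != 0 -> mmap iota xi H != 0.
Proof.
move=> hH HP; apply: contraNneq HP => H0.
by have [_ h _] := hL; apply/eqP; apply: (proj1 (h _ _ hH) H0).
Qed.

(** A form that is zero in the function field vanishes on X, so two fractions
    that represent the same function have the same value. *)
Lemma has_value_uniq f c c' : has_value P f c -> has_value P f c' -> c = c'.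
Proof.
move=> [e [G [H [hG hH HP -> ->]]]] [e' [G' [H' [hG' hH' HP' E ->]]]].
have nH := form_neq0 hH HP; have nH' := form_neq0 hH' HP'.
apply/eqP; rewrite eqr_div // -subr_eq0 -!mevalM -mevalB; apply/eqP.
have [_ h _] := hL.
have hom : G * H' - G' * H \is (e + e').-homog.
  by apply: rpredB; [|rewrite addnC]; apply: dhomogM.
apply: (proj1 (h _ _ hom)) XP.
by rewrite rmorphB !rmorphM /=; apply/eqP; rewrite subr_eq0 -eqr_div //; apply/eqP.
Qed.

Lemma has_value_const c : has_value P (iota c) c.
Proof.
exists 0%N, c%:MP, 1; rewrite dhomog1 meval1 oner_eq0 mevalC divr1 rmorph1.
rewrite mmapC divr1; split=> //.
exact: homog_mconst.
Qed.

Lemma has_valueD f g a b :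
  has_value P f a -> has_value P g b -> has_value P (f + g) (a + b).
Proof.
move=> [e [G [H [hG hH HP -> ->]]]] [e' [G' [H' [hG' hH' HP' -> ->]]]].
have nH := form_neq0 hH HP; have nH' := form_neq0 hH' HP'.
exists (e + e')%N, (G * H' + G' * H), (H * H').
have hom : G * H' + G' * H \is (e + e').-homog.
  by apply: rpredD; [|rewrite addnC]; apply: dhomogM.
rewrite hom dhomogM //.
by rewrite mevalD !mevalM mulf_neq0 // !addf_div // rmorphD !rmorphM.
Qed.

Lemma has_valueM f g a b :
  has_value P f a -> has_value P g b -> has_value P (f * g) (a * b).
Proof.
move=> [e [G [H [hG hH HP -> ->]]]] [e' [G' [H' [hG' hH' HP' -> ->]]]].
exists (e + e')%N, (G * G'), (H * H').
by rewrite !dhomogM // !mevalM mulf_neq0 // !mulf_div !rmorphM.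
Qed.

Lemma has_valueV f a : has_value P f a -> a != 0 -> has_value P f^-1 a^-1.
Proof.
move=> [e [G [H [hG hH HP -> ->]]]] nz; exists e, H, G; rewrite !invf_div.
by split=> //; apply: contraNneq nz => ->; rewrite mul0r.
Qed.

Lemma has_value_coord i j : P j != 0 -> has_value P (xi i / xi j) (P i / P j).
Proof.
move=> Pj; exists 1%N, 'X_i, 'X_j.
by rewrite !homog_mvar !mevalXU !mmapX !mmap1U.
Qed.

Lemma has_value1 : has_value P 1 1.
Proof. by rewrite -{1}(rmorph1 iota); apply: has_value_const. Qed.

Lemma has_value0 : has_value P 0 0.
Proof. by rewrite -{1}(rmorph0 iota); apply: has_value_const. Qed.

Lemma has_valueN f a : has_value P f a -> has_value P (- f) (- a).
Proof.
move=> h; have := has_valueM (has_value_const (-1)) h.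
by rewrite rmorphN rmorph1 !mulN1r.
Qed.

Lemma has_valueX f a e : has_value P f a -> has_value P (f ^+ e) (a ^+ e).
Proof.
move=> h; elim: e => [|e IH]; first exact: has_value1.
by rewrite !exprS; apply: has_valueM.
Qed.

Lemma has_value_sum (I : Type) (r : seq I) (F : I -> L) (c : I -> K) :
  (forall i, has_value P (F i) (c i)) ->
  has_value P (\sum_(i <- r) F i) (\sum_(i <- r) c i).
Proof.
move=> h; apply: (big_ind2 (fun f a => has_value P f a)) => //.
- exact: has_value0.
- by move=> *; apply: has_valueD.
Qed.

Lemma has_value_prod (I : Type) (r : seq I) (F : I -> L) (c : I -> K) :
  (forall i, has_value P (F i) (c i)) ->
  has_value P (\prod_(i <- r) F i) (\prod_(i <- r) c i).
Proof.
move=> h; apply: (big_ind2 (fun f a => has_value P f a)) => //.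
- exact: has_value1.
- by move=> *; apply: has_valueM.
Qed.

Lemma has_value_horner p f a :
  has_value P f a -> has_value P (map_poly iota p).[f] p.[a].
Proof.
move=> h; elim/poly_ind: p => [|p c IH].
  by rewrite rmorph0 !horner0; apply: has_value0.
rewrite rmorphD rmorphM /= map_polyX map_polyC /= !hornerE.
by apply: has_valueD; [apply: has_valueM | apply: has_value_const].
Qed.

Lemma regular_const c : regular_at iota xi P (iota c).
Proof. exact: has_value_regular (has_value_const c). Qed.

Lemma regularD f g : regular_at iota xi P f -> regular_at iota xi P g ->
  regular_at iota xi P (f + g).
Proof.
by move=> /regular_atP[a ha] /regular_atP[b /(has_valueD ha)/has_value_regular].
Qed.

Lemma regularM f g : regular_at iota xi P f -> regular_at iota xi P g ->
  regular_at iota xi P (f * g).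
Proof.
by move=> /regular_atP[a ha] /regular_atP[b /(has_valueM ha)/has_value_regular].
Qed.

Lemma regularN f : regular_at iota xi P f -> regular_at iota xi P (- f).
Proof. by move=> /regular_atP[a /has_valueN/has_value_regular]. Qed.

Lemma regularX f e : regular_at iota xi P f -> regular_at iota xi P (f ^+ e).
Proof. by move=> /regular_atP[a /has_valueX-/(_ e)/has_value_regular]. Qed.

Lemma regularV f a : has_value P f a -> a != 0 -> regular_at iota xi P f^-1.
Proof. by move=> h /(has_valueV h)/has_value_regular. Qed.

Lemma regular_sum (I : Type) (r : seq I) (F : I -> L) :
  (forall i, regular_at iota xi P (F i)) ->
  regular_at iota xi P (\sum_(i <- r) F i).
Proof.
move=> h; apply: (big_ind (regular_at iota xi P)) => //.
- exact: has_value_regular has_value0.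
- by move=> *; apply: regularD.
Qed.

Lemma regular_prod (I : Type) (r : seq I) (F : I -> L) :
  (forall i, regular_at iota xi P (F i)) ->
  regular_at iota xi P (\prod_(i <- r) F i).
Proof.
move=> h; apply: (big_ind (regular_at iota xi P)) => //.
- exact: has_value_regular has_value1.
- by move=> *; apply: regularM.
Qed.

End AtPoint.

(** * Diagonal automorphisms of the function field *)

(** The form G(s_0 X_0, ..., s_n X_n). *)
Definition rescale (s : 'I_n.+1 -> K) (G : {mpoly K[n.+1]}) : {mpoly K[n.+1]} :=
  \sum_(u <- msupp G) (G@_u * mmap1 s u) *: 'X_[u].

Lemma mmap_rescale (R : fieldType) (j : {rmorphism K -> R}) v s G :
  mmap j v (rescale s G) = mmap j (fun i => j (s i) * v i) G.
Proof.
rewrite /rescale raddf_sum; apply: eq_bigr => u _ /=.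
rewrite mmapZ mmapX rmorphM -mulrA; congr (_ * _).
rewrite /mmap1 rmorph_prod -big_split /=; apply: eq_bigr => i _.
by rewrite exprMn rmorphXn.
Qed.

Lemma meval_rescale s G P : (rescale s G).@[P] = G.@[fun i => s i * P i].
Proof. exact: (mmap_rescale idfun). Qed.

Lemma rescale_homog s e G : G \is e.-homog -> rescale s G \is e.-homog.
Proof.
move/dhomogP=> hG; rewrite /rescale big_seq rpred_sum // => u /hG hu.
by rewrite rpredZ // dhomogX hu.
Qed.

(** A form vanishes on X if and only if its rescaling does, so rescaling
    numerator and denominator gives a function that depends only on the
    fraction.  It carries the local ring at s P to the one at P. *)
Lemma diagonal_automorphism (s : 'I_n.+1 -> K) :
  s ord0 = 1 -> (forall i, s i != 0) ->
  (forall P, X P -> X (fun i => s i * P i)) ->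
  (forall P, X P -> X (fun i => (s i)^-1 * P i)) ->
  exists sg : {rmorphism L -> L},
    [/\ forall c, sg (iota c) = iota c,
        forall i, sg (xi i) = iota (s i) * xi i
      & forall P f c, X P -> has_value (fun i => s i * P i) f c ->
          has_value P (sg f) c].
Proof.
move=> s0 snz hs hsV; have [x0 hX hrat] := hL.
pose phi := mmap iota xi.
pose psi G := mmap iota (fun i => iota (s i) * xi i) G.
have psiE G : psi G = phi (rescale s G) by rewrite /phi mmap_rescale.
have psi0 e G : G \is e.-homog -> (phi G == 0) = (psi G == 0).
  move=> hG; rewrite psiE; apply/eqP/eqP => [|].
    move/(proj1 (hX _ _ hG)) => h.
    apply/(proj2 (hX _ _ (rescale_homog s hG))) => P XP.
    by rewrite meval_rescale h //; apply: hs.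
  move/(proj1 (hX _ _ (rescale_homog s hG))) => h.
  apply/(proj2 (hX _ _ hG)) => P XP.
  have := h _ (hsV _ XP); rewrite meval_rescale => E0; rewrite -[RHS]E0.
  by apply: meval_eq => i; rewrite mulrA divff ?mul1r.
pose rep f (t : nat * {mpoly K[n.+1]} * {mpoly K[n.+1]}) :=
  [&& t.1.2 \is (t.1.1).-homog, t.2 \is (t.1.1).-homog, phi t.2 != 0
    & f == phi t.1.2 / phi t.2].
have ex_rep f : exists t, rep f t.
  have [e [G [H [hG hH nH ->]]]] := hrat f.
  by exists (e, G, H); rewrite /rep hG hH nH /=.
(* Being a representing fraction is a boolean property on a type with choice,
   so a representative can be picked without an axiom. *)
pose sg f := let t := xchoose (ex_rep f) in psi t.1.2 / psi t.2.
have sgE e G H : G \is e.-homog -> H \is e.-homog -> phi H != 0 ->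
    sg (phi G / phi H) = psi G / psi H.
  move=> hG hH nH; rewrite /sg; have := xchooseP (ex_rep (phi G / phi H)).
  move: (xchoose _) => [[e' G'] H'] /and4P[/= hG' hH' nH' /eqP E].
  apply/eqP; rewrite eqr_div -?(psi0 _ _ hH) -?(psi0 _ _ hH') //.
  rewrite -subr_eq0 /psi -!rmorphM -rmorphB -/(psi _) -(psi0 (e + e')%N).
    by rewrite /phi rmorphB !rmorphM subr_eq0 -eqr_div // -E eqxx.
  by apply: rpredB; [rewrite addnC|]; apply: dhomogM.
have sgZ : zmod_morphism sg.
  move=> f g; have [e [G [H [hG hH nH ->]]]] := hrat f.
  have [e' [G' [H' [hG' hH' nH' ->]]]] := hrat g.
  have frac (h : {rmorphism {mpoly K[n.+1]} -> L}) : h H != 0 -> h H' != 0 ->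
      h G / h H - h G' / h H' = h (G * H' - G' * H) / h (H * H').
    by move=> nz nz'; rewrite rmorphB !rmorphM; field; rewrite nz nz'.
  rewrite (frac phi) // (sgE (e + e')%N).
  - by rewrite (sgE _ _ _ hG hH nH) (sgE _ _ _ hG' hH' nH') (frac psi) // -?(psi0 _ _ hH) -?(psi0 _ _ hH').
  - by apply: rpredB; [|rewrite addnC]; apply: dhomogM.
  - by rewrite dhomogM.
  - by rewrite /phi rmorphM mulf_neq0.
have sgM : monoid_morphism sg.
  split.
    have h1 := @dhomog1 n.+1 K (@mdeg n.+1).
    have := sgE _ _ _ h1 h1; rewrite /phi /psi !rmorph1 !divr1; apply.
    exact: oner_neq0.
  move=> f g; have [e [G [H [hG hH nH ->]]]] := hrat f.
  have [e' [G' [H' [hG' hH' nH' ->]]]] := hrat g.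
  have frac (h : {rmorphism {mpoly K[n.+1]} -> L}) :
      h G / h H * (h G' / h H') = h (G * G') / h (H * H').
    by rewrite mulf_div !rmorphM.
  rewrite (frac phi) (sgE (e + e')%N) ?dhomogM //.
    by rewrite (sgE _ _ _ hG hH nH) (sgE _ _ _ hG' hH' nH') (frac psi).
  by rewrite /phi rmorphM mulf_neq0.
have zm := GRing.isZmodMorphism.Build _ _ sg sgZ.
have mm := GRing.isMonoidMorphism.Build _ _ sg sgM.
pose sgR : {rmorphism L -> L} := HB.pack_for (GRing.RMorphism.type L L) sg zm mm.
exists sgR; split=> [c|i|P f c XP [e [G [H [hG hH nH -> ->]]]]] /=.
- have h1 := @dhomog1 n.+1 K (@mdeg n.+1).
  have := sgE _ _ _ (homog_mconst c) h1; rewrite /phi /psi !rmorph1 !divr1 !mmapC; apply.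
  exact: oner_neq0.
- have := sgE _ _ _ (homog_mvar i) (homog_mvar ord0); rewrite /phi /psi !mmapX !mmap1U x0 s0.
  by rewrite rmorph1 mulr1 !divr1; apply; apply: oner_neq0.
- rewrite (sgE _ _ _ hG hH).
    exists e, (rescale s G), (rescale s H).
    by rewrite !rescale_homog // !meval_rescale !psiE.
  exact: (form_neq0 (hs P XP) hH nH).
Qed.
(** * Derivations of the function field *)

(** A derivation on forms that kills the ideal of X extends to the function
    field by the quotient rule. *)
Lemma quotient_derivation (D0 : {mpoly K[n.+1]} -> L) :
  (forall c, D0 c%:MP = 0) -> {morph D0 : G H / G - H} ->
  (forall G H, D0 (G * H) = mmap iota xi G * D0 H + mmap iota xi H * D0 G) ->
  (forall G, mmap iota xi G = 0 -> D0 G = 0) ->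
  exists D : L -> L^o, is_derivation iota D /\
    (forall i, D (xi i) = D0 'X_i - xi i * D0 'X_ord0).
Proof.
move=> D0C D0B D0M D0van; have [x0 hX hrat] := hL.
pose phi := mmap iota xi.
pose quo G H := (D0 G * phi H - phi G * D0 H) / phi H ^+ 2.
have D00 : D0 0 = 0 by rewrite -[0](subrr 0) D0B subrr.
have D0D G H : D0 (G + H) = D0 G + D0 H.
  by rewrite -{1}[H]opprK D0B -[- H]sub0r D0B D00 sub0r opprK.
pose rep f (t : {mpoly K[n.+1]} * {mpoly K[n.+1]}) :=
  (phi t.2 != 0) && (f == phi t.1 / phi t.2).
have ex_rep f : exists t, rep f t.
  have [e [G [H [_ _ nH ->]]]] := hrat f.
  by exists (G, H); rewrite /rep nH /=.
pose D f : L^o := let t := xchoose (ex_rep f) in quo t.1 t.2.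
have DE G H : phi H != 0 -> D (phi G / phi H) = quo G H.
  move=> nH; rewrite /D; have := xchooseP (ex_rep (phi G / phi H)).
  move: (xchoose _) => [G' H'] /andP[/= nH' /eqP E].
  have {}E : phi G * phi H' = phi G' * phi H.
    by apply/eqP; rewrite -eqr_div // E.
  have /D0van : phi (G * H' - G' * H) = 0.
    by rewrite /phi rmorphB !rmorphM -!/(phi _) E subrr.
  rewrite D0B !D0M -!/(phi _) => /eqP; rewrite subr_eq0 => /eqP E'.
  apply/eqP; rewrite /quo eqr_div ?expf_neq0 // -subr_eq0.
  rewrite (_ : _ - _ =
     phi H * phi H' * ((phi G' * D0 H + phi H * D0 G')
                      - (phi G * D0 H' + phi H' * D0 G))
     + (phi G * phi H' - phi G' * phi H) *
       (phi H' * D0 H + phi H * D0 H')); first by rewrite E E' !subrr mulr0 mul0r addr0.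
  by ring.
have D0one : D0 1 = 0 by exact: D0C.
have DE1 G : D (phi G) = D0 G.
  have := DE G 1; rewrite /quo /phi rmorph1 divr1 D0one => -> //.
    by rewrite mulr1 mulr0 subr0 expr1n divr1.
  exact: oner_neq0.
exists D; split; last first.
  move=> i; have /(_ i) : forall i, phi 'X_i = xi i.
    by move=> j; rewrite /phi mmapX mmap1U.
  move=> E; have E0 : phi 'X_ord0 = 1 by rewrite /phi mmapX mmap1U.
  have := DE 'X_i 'X_ord0; rewrite /quo E E0 oner_neq0 divr1 => -> //.
  by rewrite mulr1 expr1n divr1.
split=> [c|f g|f g].
- by have := DE1 c%:MP; rewrite /phi mmapC D0C.
- have [e [G [H [_ _ nH ->]]]] := hrat f.
  have [e' [G' [H' [_ _ nH' ->]]]] := hrat g.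
  rewrite -!/(phi _) (addf_div _ _ nH nH').
  have -> : phi G * phi H' + phi G' * phi H = phi (G * H' + G' * H).
    by rewrite /phi rmorphD !rmorphM.
  have -> : phi H * phi H' = phi (H * H') by rewrite /phi rmorphM.
  have nHH : phi (H * H') != 0 by rewrite /phi rmorphM mulf_neq0.
  rewrite !DE // /quo D0D !D0M /phi rmorphD !rmorphM -!/(phi _).
  by field; rewrite nH nH'.
- have [e [G [H [_ _ nH ->]]]] := hrat f.
  have [e' [G' [H' [_ _ nH' ->]]]] := hrat g.
  rewrite -!/(phi _) mulf_div.
  have -> : phi G * phi G' = phi (G * G') by rewrite /phi rmorphM.
  have -> : phi H * phi H' = phi (H * H') by rewrite /phi rmorphM.
  have nHH : phi (H * H') != 0 by rewrite /phi rmorphM mulf_neq0.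
  rewrite !DE // /quo !D0M /phi !rmorphM -!/(phi _) /GRing.scale /=.
  by field; rewrite nH nH'.
Qed.

End Values.

(** * Derivations and spans of differentials *)

Section DerivationRules.
Variables (K L : fieldType) (iota : {rmorphism K -> L}).
Variables (M : lmodType L) (D : L -> M).
Hypothesis hD : is_derivation iota D.

Lemma derivationC c : D (iota c) = 0. Proof. by case: hD. Qed.

Lemma derivationD f g : D (f + g) = D f + D g. Proof. by case: hD. Qed.

Lemma derivationM f g : D (f * g) = f *: D g + g *: D f. Proof. by case: hD. Qed.

Lemma derivation1 : D 1 = 0.
Proof. by rewrite -(rmorph1 iota) derivationC. Qed.

Lemma derivationXn f e : D (f ^+ e) = (e%:R * f ^+ e.-1) *: D f.
Proof.
elim: e => [|e IH]; first by rewrite expr0 derivation1 mul0r scale0r.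
rewrite exprS derivationM IH scalerA -scalerDl; congr (_ *: _).
case: e {IH} => [|e] /=; rewrite ?mul0r ?mulr0 ?add0r ?expr0 ?mul1r //.
by rewrite exprS; ring.
Qed.

Lemma derivationV f : f != 0 -> D f^-1 = - f ^- 2 *: D f.
Proof.
move=> nf; have := derivationM f f^-1; rewrite divff // derivation1 => /esym/eqP.
rewrite addr_eq0 => /eqP E.
have -> : D f^-1 = f^-1 *: (f *: D f^-1) by rewrite scalerA mulVf // scale1r.
by rewrite E scalerN scalerA scaleNr expr2 invfM.
Qed.

Section Span.
Variables (O : L -> Prop) (w : M).
Hypothesis OC : forall c, O (iota c).
Hypothesis OD : forall f g, O f -> O g -> O (f + g).
Hypothesis OM : forall f g, O f -> O g -> O (f * g).

(** For a subring O the functions f in O with df in O w are again a subring;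
    taking for O a local ring, or the whole field, shows that it suffices to
    compute the differentials of coordinates. *)
Definition in_span f := O f /\ exists2 g, O g & D f = g *: w.

Lemma in_spanC c : in_span (iota c).
Proof.
split=> //; exists 0; last by rewrite scale0r derivationC.
by rewrite -(rmorph0 iota).
Qed.

Lemma in_spanD f g : in_span f -> in_span g -> in_span (f + g).
Proof.
move=> [Of [a Oa Df]] [Og [b Ob Dg]]; split; first exact: OD.
by exists (a + b); [exact: OD | rewrite derivationD Df Dg scalerDl].
Qed.

Lemma in_spanM f g : in_span f -> in_span g -> in_span (f * g).
Proof.
move=> [Of [a Oa Df]] [Og [b Ob Dg]]; split; first exact: OM.
exists (f * b + g * a); last by rewrite derivationM Df Dg !scalerA scalerDl.
by apply: OD; apply: OM.
Qed.

Lemma in_spanV f : f != 0 -> in_span f -> O f^-1 -> in_span f^-1.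
Proof.
move=> nf [Of [a Oa Df]] OV; split=> //.
exists (iota (-1) * (f^-1 * f^-1) * a).
  by do !apply: OM.
by rewrite derivationV // Df scalerA rmorphN rmorph1 mulN1r expr2 invfM.
Qed.

Lemma in_span_mmap n (u : 'I_n -> L) (G : {mpoly K[n]}) :
  (forall i, in_span (u i)) -> in_span (mmap iota u G).
Proof.
move=> hu; rewrite /mmap; apply: (big_ind in_span).
- by rewrite -(rmorph0 iota); apply: in_spanC.
- exact: in_spanD.
move=> m _; apply: in_spanM; first exact: in_spanC.
rewrite /mmap1; apply: (big_ind in_span).
- by rewrite -(rmorph1 iota); apply: in_spanC.
- exact: in_spanM.
move=> i _; elim: (m i) => [|e IH]; last by rewrite exprS; apply: in_spanM.
by rewrite expr0 -(rmorph1 iota); apply: in_spanC.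
Qed.

End Span.
End DerivationRules.

(** * One-dimensional modules of differentials and their tensor powers *)

(** If the differentials are all multiples of dx, then w and phi(w) dx agree on
    them for the functional phi induced by D, so they agree everywhere by the
    uniqueness part of the universal property. *)
Lemma kaehler_generated (K L : fieldType) (iota : {rmorphism K -> L})
    (Omega : lmodType L) (d : L -> Omega) (D : L -> L^o) (x : L) :
  is_kaehler iota d -> is_derivation iota D -> D x = 1 ->
  (forall f, exists c, d f = c *: d x) ->
  exists2 phi : {linear Omega -> L^o},
    phi (d x) = 1 & forall w, w = phi w *: d x.
Proof.
move=> [hd univ] hD Dx1 gen.
have [[phi hphi] _] := univ _ _ hD.
have [_ uniq] := univ _ _ hd.
pose f w := phi w *: d x.
have flin : linear f.
  by move=> a u v; rewrite /f linearP scalerDl scalerA.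
have fl := GRing.isLinear.Build _ _ _ _ f flin.
pose fL : {linear Omega -> Omega} := HB.pack_for {linear Omega -> Omega} f fl.
exists phi; first by rewrite hphi.
move=> w; rewrite -/(f w) -[RHS]/(fL w); apply: (uniq idfun fL) => g /=.
rewrite /f hphi; have [c E] := gen g; rewrite E.
by rewrite -hphi E linearZ /= hphi Dx1 /GRing.scale /= mulr1.
Qed.

Section TensorPower.
Variables (L : fieldType) (m : nat) (V T : lmodType L).
Variable tens : {ffun 'I_m -> V} -> T.
Hypothesis htens : multilinear tens.

(** The scalars are moved out of the tensor one index at a time. *)
Lemma multilinear_scale (c : 'I_m -> L) (v : V) :
  tens [ffun i => c i *: v] = (\prod_i c i) *: tens [ffun => v].
Proof.
have upd0 w i : tens (upd w i 0) = 0.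
  have := htens w i 1 0 0; rewrite !scale1r addr0.
  by move=> /(congr1 (fun z => z - tens (upd w i 0))); rewrite subrr addrK.
have updZ w i a u : tens (upd w i (a *: u)) = a *: tens (upd w i u).
  by have := htens w i a u 0; rewrite addr0 upd0 addr0.
suff key (r : seq 'I_m) : uniq r ->
    tens [ffun i => (if i \in r then c i else 1) *: v]
    = (\prod_(i <- r) c i) *: tens [ffun => v].
  rewrite -key ?index_enum_uniq //; congr (tens _).
  by apply/ffunP => i; rewrite !ffunE mem_index_enum.
elim: r => [|j r IH] /= => [_|/andP[jr ur]].
  by rewrite big_nil !scale1r.
rewrite big_cons -scalerA -IH //.
set w := [ffun i => (if i \in r then c i else 1) *: v].
have -> : w = upd w j v.
  by apply/ffunP => i; rewrite !ffunE; case: eqP => // ->; rewrite (negbTE jr) scale1r.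
rewrite -updZ; congr (tens _); apply/ffunP => i; rewrite !ffunE inE.
by case: eqP => [->|].
Qed.

Lemma multilinear_scale_cst (c : L) (v : V) :
  tens [ffun => c *: v] = c ^+ m *: tens [ffun => v].
Proof. by rewrite (multilinear_scale (fun=> c)) prodr_const card_ord. Qed.

End TensorPower.

(** The product of the values of phi is a multilinear form which is 1 on
    v (x) ... (x) v; the induced functional psi on T is the coordinate. *)
Lemma tensor_power_generated (L : fieldType) (m : nat) (V T : lmodType L)
    (tens : {ffun 'I_m -> V} -> T) (phi : {linear V -> L^o}) (v : V) :
  is_tensor_power tens -> phi v = 1 -> (forall w, w = phi w *: v) ->
  (forall w, exists h, w = h *: tens [ffun => v]) /\
  (forall h, h *: tens [ffun => v] = 0 -> h = 0).
Proof.
move=> [hm univ] phiv hphi.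
pose g (w : {ffun 'I_m -> V}) : L^o := \prod_i phi (w i).
have hg : multilinear g.
  move=> w i c u u'; rewrite /g.
  have E z : \prod_(j < m) phi (upd w i z j) =
      phi z * \prod_(j < m | j != i) phi (w j).
    rewrite (bigD1 i) //= !ffunE eqxx; congr (_ * _).
    by apply: eq_bigr => j /negbTE ji; rewrite ffunE ji.
  by rewrite !E linearP mulrDl /GRing.scale /= mulrA.
have [[psi hpsi] _] := univ _ _ hg.
have [_ uniq] := univ _ _ hm.
have psi1 : psi (tens [ffun => v]) = 1.
  by rewrite hpsi /g big1 // => i _; rewrite ffunE.
split=> [w|h E]; last first.
  by have := congr1 psi E; rewrite linearZ /= psi1 raddf0 /GRing.scale /= mulr1.
pose f w := psi w *: tens [ffun => v].
have flin : linear f.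
  by move=> a u u'; rewrite /f linearP scalerDl scalerA.
have fl := GRing.isLinear.Build _ _ _ _ f flin.
pose fL : {linear T -> T} := HB.pack_for {linear T -> T} f fl.
exists (psi w); rewrite -/(f w) -[RHS]/(fL w); apply: (uniq idfun fL) => u /=.
rewrite /f hpsi /g -multilinear_scale //; congr (tens _).
by apply/ffunP => i; rewrite ffunE -hphi.
Qed.

(** * Stalks of the sheaf of m-differentials *)

Section Stalk.
Variables (K L : fieldType) (n m : nat) (X : ('I_n.+1 -> K) -> Prop).
Variables (iota : {rmorphism K -> L}) (xi : 'I_n.+1 -> L).
Hypothesis hL : is_function_field X iota xi.
Variables (Omega : lmodType L) (d : L -> Omega).
Hypothesis hd : is_derivation iota d.
Variables (T : lmodType L) (tens : {ffun 'I_m -> Omega} -> T).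
Hypothesis htens : multilinear tens.

(** Passage from the chart X_0 <> 0 to the chart X_j <> 0. *)
Lemma mmap_homog_ratio j e (G : {mpoly K[n.+1]}) :
  xi j != 0 -> G \is e.-homog ->
  mmap iota xi G = xi j ^+ e * mmap iota (fun i => xi i / xi j) G.
Proof.
move=> nz hG; rewrite /mmap big_distrr /= big_seq [RHS]big_seq.
apply: eq_bigr => u hu; rewrite mulrCA; congr (_ * _).
rewrite -(dhomogP _ _ _ hG u hu) /= mdegE /mmap1 -prodrXr -big_split /=; apply: eq_bigr => i _.
by rewrite -exprMn mulrCA divff // mulr1.
Qed.

Lemma coord_neq0 P j : X P -> P j != 0 -> xi j != 0.
Proof.
move=> XP Pj; have := form_neq0 hL XP (homog_mvar _ j).
by rewrite mevalXU mmapX mmap1U; apply.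
Qed.

(** The local ring at P is a localization of the ring generated by the ratios
    X_i / X_j, so their differentials generate its module of differentials. *)
Lemma d_regular P j (w : Omega) : X P -> P j != 0 ->
  (forall i, exists2 g, regular_at iota xi P g & d (xi i / xi j) = g *: w) ->
  forall f, regular_at iota xi P f ->
    exists2 g, regular_at iota xi P g & d f = g *: w.
Proof.
move=> XP Pj hw f [e [G [H [hG hH HP ->]]]].
have nxj := coord_neq0 XP Pj.
have nH := form_neq0 hL XP hH HP.
have OC := regular_const iota xi P.
have OD := regularD hL XP; have OM := @regularM _ _ _ iota xi P.
have hu i : in_span d (regular_at iota xi P) w (xi i / xi j).
  by split=> //; apply: has_value_regular (has_value_coord iota xi i Pj).
set u := fun i => xi i / xi j in hu.
have nHu : mmap iota u H != 0.
  by apply: contraNneq nH => E; rewrite (mmap_homog_ratio nxj hH) E mulr0.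
have -> : mmap iota xi G / mmap iota xi H = mmap iota u G / mmap iota u H.
  rewrite !(mmap_homog_ratio nxj hG) (mmap_homog_ratio nxj hH) -/u.
  by rewrite -mulf_div divff ?mul1r // expf_neq0.
have [] // : in_span d (regular_at iota xi P) w (mmap iota u G / mmap iota u H).
apply: (in_spanM hd OD OM); first exact: (in_span_mmap hd).
apply: (in_spanV hd) => //; first exact: (in_span_mmap hd).
exists e, ('X_j ^+ e), H.
rewrite rmorphXn /= mmapX mmap1U (mmap_homog_ratio nxj hH) -/u; split=> //.
  by have := dhomogMn e (homog_mvar K j); rewrite mul1n.
by rewrite invfM mulrA divff ?mul1r // expf_neq0.
Qed.

(** When dt generates the differentials of the local ring, each
    df_1 (x) ... (x) df_m is a regular multiple of dt (x) ... (x) dt. *)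
Lemma stalk_generated P t : X P -> regular_at iota xi P t ->
  (forall f, regular_at iota xi P f ->
    exists2 g, regular_at iota xi P g & d f = g *: d t) ->
  forall w, mdiff_regular_at iota xi d tens P w <->
    exists2 g, regular_at iota xi P g & w = g *: tens [ffun => d t].
Proof.
move=> XP Ot ht w; split=> [[N [g [f [Og Of ->]]]]|[g Og ->]]; last first.
  exists 1%N, (fun=> g), (fun _ _ => t); split=> //.
  by rewrite big_ord1.
have hf s : exists2 h, regular_at iota xi P h &
    tens [ffun i => d (f s i)] = h *: tens [ffun => d t].
  have [h hh] : exists h : 'I_m -> L, forall i,
      regular_at iota xi P (h i) /\ d (f s i) = h i *: d t.
    apply: (@fin_all_exists _ _ (fun i a =>
       regular_at iota xi P a /\ d (f s i) = a *: d t)) => i.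
    by have [a] := ht _ (Of s i); exists a.
  exists (\prod_i h i).
    by apply: regular_prod => i; case: (hh i).
  rewrite -(multilinear_scale htens); congr (tens _); apply/ffunP => i.
  by rewrite !ffunE; case: (hh i).
have OD := regularD hL XP; have OM := @regularM _ _ _ iota xi P.
apply: (big_ind (fun v => exists2 g, regular_at iota xi P g &
   v = g *: tens [ffun => d t])).
- exists 0; last by rewrite scale0r.
  exact: (has_value_regular (has_value0 iota xi P)).
- move=> _ _ [a Oa ->] [b Ob ->]; exists (a + b); first exact: OD.
  by rewrite scalerDl.
move=> s _; have [h Oh ->] := hf s; exists (g s * h); first exact: OM.
by rewrite scalerA.
Qed.

End Stalk.

(** * Coordinates on the generalized Fermat curve *)

Section Coordinates.
Variable N : nat.

Definition i0 : 'I_N.+2 := ord0.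
Definition i1 : 'I_N.+2 := lift ord0 ord0.
Definition iy (j : 'I_N) : 'I_N.+2 := lift ord0 (lift ord0 j).

Lemma coord_ind (A : 'I_N.+2 -> Prop) :
  A i0 -> A i1 -> (forall j, A (iy j)) -> forall i, A i.
Proof.
move=> A0 A1 Ay i; case: (unliftP ord0 i) => [i'|] -> //.
by case: (unliftP ord0 i') => [j|] ->; [apply: Ay | apply: A1].
Qed.

Lemma inord1E : inord 1 = i1.
Proof. by apply: val_inj; rewrite /= inordK //= /bump. Qed.

Lemma inordyE (j : 'I_N) : inord j.+2 = iy j.
Proof. by apply: val_inj; rewrite /= inordK /bump //= !ltnS ltn_ord. Qed.

(** The vector (a, b, f_0, ..., f_(N-1)) in homogeneous coordinates. *)
Definition coords (A : Type) (a b : A) (f : 'I_N -> A) (i : 'I_N.+2) : A :=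
  oapp (fun i' => oapp f b (unlift ord0 i')) a (unlift ord0 i).

Lemma coords0 A a b f : @coords A a b f i0 = a.
Proof. by rewrite /coords unlift_none. Qed.

Lemma coords1 A a b f : @coords A a b f i1 = b.
Proof. by rewrite /coords liftK /= unlift_none. Qed.

Lemma coordsy A a b f j : @coords A a b f (iy j) = f j.
Proof. by rewrite /coords /iy liftK /= liftK. Qed.

Definition coordsE := (coords0, coords1, coordsy).

Lemma big_coords (R : Type) (idx : R) (op : Monoid.com_law idx)
    (F : 'I_N.+2 -> R) :
  \big[op/idx]_i F i =
    op (F i0) (op (F i1) (\big[op/idx]_(j < N) F (iy j))).
Proof. by rewrite !big_ord_recl. Qed.

End Coordinates.
Arguments i0 {N}.
Arguments i1 {N}.

Section Fermat.
Variables (K : closedFieldType) (k N : nat) (mu : 'I_N -> K).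
Hypothesis k_gt1 : (1 < k)%N.
Hypothesis k_neq0 : k%:R != 0 :> K.
Hypothesis mu_neq0 : forall j, mu j != 0.
Hypothesis mu_inj : injective mu.
Variable X : ('I_N.+2 -> K) -> Prop.
Hypothesis XE : forall P, X P <-> (exists i, P i != 0) /\
  forall j, mu j * P i0 ^+ k + P i1 ^+ k + P (iy j) ^+ k = 0.
Variables (L : fieldType) (iota : {rmorphism K -> L}) (xi : 'I_N.+2 -> L).
Hypothesis hL : is_function_field X iota xi.

Let k_gt0 : (0 < k)%N := ltnW k_gt1.

Notation x := (xi i1).
Notation y j := (xi (iy j)).

Lemma xi0 : xi i0 = 1. Proof. by case: hL. Qed.

Lemma fermat_relation j : iota (mu j) + x ^+ k + y j ^+ k = 0.
Proof.
have [_ h _] := hL.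
pose G : {mpoly K[N.+2]} := mu j *: 'X_i0 ^+ k + 'X_i1 ^+ k + 'X_(iy j) ^+ k.
have hX i : ('X_i ^+ k : {mpoly K[N.+2]}) \is k.-homog.
  by have := dhomogMn k (homog_mvar K i); rewrite mul1n.
have hG : G \is k.-homog by apply: rpredD; [apply: rpredD; [apply: rpredZ|]|]; exact: hX.
have := proj2 (h _ _ hG); rewrite /G !rmorphD !rmorphXn /= mmapZ rmorphXn /=.
rewrite !mmapX !mmap1U xi0 expr1n mulr1; apply => P /XE[_ /(_ j)].
by rewrite !mevalD mevalZ !rmorphXn /= !mevalXU.
Qed.

Lemma y_pow j : y j ^+ k = - (iota (mu j) + x ^+ k).
Proof. by apply/eqP; rewrite -addr_eq0 addrC fermat_relation. Qed.

(** * Points of the curve *)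

Lemma kth_root (a : K) : exists z, z ^+ k = a.
Proof.
have /closed_rootP[z] : size ('X^k - a%:P) != 1%N.
  by rewrite size_XnsubC // eqSS -lt0n.
by rewrite /root !hornerE subr_eq0 => /eqP; exists z.
Qed.

Lemma affine_point (x0 : K) : exists P, [/\ X P, P i0 = 1 & P i1 = x0].
Proof.
have [f hf] : exists f : 'I_N -> K, forall j, f j ^+ k = - (mu j + x0 ^+ k).
  apply: (@fin_all_exists _ _ (fun j z => z ^+ k = - (mu j + x0 ^+ k))) => j.
  exact: kth_root.
exists (coords 1 x0 f); rewrite !coordsE; split=> //.
apply/XE; split; first by exists i0; rewrite coordsE oner_neq0.
by move=> j; rewrite !coordsE hf expr1n mulr1 subrr.
Qed.

Lemma point_at_infinity : exists2 P, X P & P i0 = 0.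
Proof.
have [z hz] := kth_root (-1).
exists (coords 0 1 (fun=> z)); last by rewrite coordsE.
apply/XE; split; first by exists i1; rewrite coordsE oner_neq0.
by move=> j; rewrite !coordsE hz expr0n (gtn_eqF k_gt0) mulr0 add0r expr1n subrr.
Qed.

Lemma infinity_coord1 P : X P -> P i0 = 0 -> P i1 != 0.
Proof.
move=> /XE[[i nz] hP] P0; apply: contraNneq nz => P1; apply/eqP.
elim/coord_ind: i => // j; have := hP j.
rewrite P0 P1 expr0n (gtn_eqF k_gt0) mulr0 !add0r => /eqP.
by rewrite expf_eq0 k_gt0 => /eqP.
Qed.

Lemma infinity_coordy P j : X P -> P i0 = 0 -> P (iy j) != 0.
Proof.
move=> XP P0; have P1 := infinity_coord1 XP P0.
move/XE: XP => [_ /(_ j)]; rewrite P0 expr0n (gtn_eqF k_gt0) mulr0 add0r.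
move=> E; apply: contraNneq P1 => Pj; move/eqP: E.
by rewrite Pj expr0n (gtn_eqF k_gt0) addr0 expf_eq0 k_gt0.
Qed.

Lemma has_value_affine P i : P i0 != 0 ->
  has_value iota xi P (xi i) (P i / P i0).
Proof.
by move=> P0; have := has_value_coord iota xi i P0; rewrite xi0 divr1.
Qed.

Definition evalx (p : {poly K}) : L := (map_poly iota p).[x].

Lemma has_value_evalx P p : X P -> P i0 != 0 ->
  has_value iota xi P (evalx p) p.[P i1 / P i0].
Proof. by move=> XP P0; apply: (has_value_horner hL XP); apply: has_value_affine. Qed.

(** Every x_0 in the infinite field K is the abscissa of an affine point. *)
Lemma evalx_eq0 p : evalx p = 0 -> p = 0.
Proof.
move=> E; apply/eqP; apply/negPn/negP => /closed_nonrootP[x0].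
have [P [XP P0 P1]] := affine_point x0; rewrite /root => /negP; apply.
have P0nz : P i0 != 0 by rewrite P0 oner_neq0.
have := has_value_evalx p XP P0nz; rewrite E P0 P1 divr1 => h.
by rewrite (has_value_uniq hL XP h (has_value0 _ _ _)).
Qed.

Lemma x_neq0 : x != 0.
Proof.
have [P [XP _ P1]] := affine_point 1.
by apply: (coord_neq0 hL XP); rewrite P1 oner_neq0.
Qed.

(** All but finitely many fibres of x avoid the zeros of y_j. *)
Lemma y_neq0 j : y j != 0.
Proof.
have /closed_nonrootP[x0] : 'X^k + (mu j)%:P != 0 :> {poly K}.
  by rewrite -size_poly_eq0 size_XnaddC.
rewrite /root !hornerE => nz; have [P [XP P0 P1]] := affine_point x0.
apply: (coord_neq0 hL XP); apply: contraNneq nz => Pj.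
move/XE: XP => [_ /(_ j)]; rewrite P0 P1 Pj expr1n mulr1.
by rewrite expr0n (gtn_eqF k_gt0) addr0 addrC => /eqP.
Qed.

Lemma iota_k_neq0 : k%:R != 0 :> L.
Proof. by rewrite -(rmorph_nat iota) fmorph_eq0. Qed.

(** * The Galois group over K(x) and its characters *)

(** A box element plays two roles: an exponent vector b of y^b, and a Galois
    automorphism s, which multiplies y_j by zeta^(s_j). *)
Definition box := {ffun 'I_N -> 'I_k}.

Definition bexp (b : box) (j : 'I_N) : nat := b j.

Definition ymon (e : 'I_N -> nat) : L := \prod_j y j ^+ e j.

Lemma ymon_neq0 e : ymon e != 0.
Proof. by apply/prodf_neq0 => j _; rewrite expf_neq0 ?y_neq0. Qed.

Lemma primitive_root : exists z : K, k.-primitive_root z.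
Proof.
have [r Er] := closed_field_poly_normal ('X^k - 1 : {poly K}).
move: Er; rewrite lead_coefXnsubC // scale1r => Er.
have sz : size r = k.
  by have := congr1 (size \o val) Er; rewrite /= size_prod_XsubC size_XnsubC // => -[].
have ur : uniq r.
  by rewrite -separable_prod_XsubC -Er separable_Xn_sub_1.
suff /hasP[z _ hz] : has k.-primitive_root r by exists z.
apply: has_prim_root; rewrite ?sz //.
apply/allP => z zr; rewrite unity_rootE -subr_eq0.
have : root ('X^k - 1) z by rewrite Er root_prod_XsubC.
by rewrite /root !hornerE.
Qed.

Variable zeta : K.
Hypothesis zeta_prim : k.-primitive_root zeta.

Definition galois_scale (s : box) : 'I_N.+2 -> K :=
  coords 1 1 (fun j => zeta ^+ s j).

Lemma zeta_neq0 : zeta != 0.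
Proof.
apply/negP => /eqP E; have := prim_expr_order zeta_prim.
by rewrite E expr0n (gtn_eqF k_gt0) => /esym/eqP; rewrite oner_eq0.
Qed.

Lemma galois_scale_neq0 s i : galois_scale s i != 0.
Proof.
by elim/coord_ind: i => [||j]; rewrite /galois_scale coordsE ?oner_neq0 ?expf_neq0 ?zeta_neq0.
Qed.

Lemma galois_scale_pow s i : galois_scale s i ^+ k = 1.
Proof.
elim/coord_ind: i => [||j]; rewrite /galois_scale coordsE ?expr1n //.
by rewrite exprAC (prim_expr_order zeta_prim) expr1n.
Qed.

Lemma X_scale (t : 'I_N.+2 -> K) P : (forall i, t i != 0) ->
  (forall i, t i ^+ k = 1) -> X P -> X (fun i => t i * P i).
Proof.
move=> nz tk /XE[[i Pi] hP]; apply/XE; split.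
  by exists i; rewrite mulf_neq0.
by move=> j; rewrite !exprMn !tk !mul1r.
Qed.

(** The last clause says that g carries the local ring at s P to the local ring
    at P and preserves values. *)
Definition galois_lift (s : box) (g : {rmorphism L -> L}) : Prop :=
  [/\ forall c, g (iota c) = iota c,
      g x = x, forall j, g (y j) = iota (zeta ^+ s j) * y j
    & forall P f c, X P -> has_value iota xi (fun i => galois_scale s i * P i) f c ->
        has_value iota xi P (g f) c].

Lemma galois_exists :
  exists sg : box -> {rmorphism L -> L}, forall s, galois_lift s (sg s).
Proof.
apply: (@fin_all_exists _ (fun=> {rmorphism L -> L}) galois_lift) => s.
have nz := galois_scale_neq0 s; have pw := galois_scale_pow s.
have [||||g [gc gx gv]] := diagonal_automorphism hL (s := galois_scale s).
- by rewrite /galois_scale coords0.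
- exact: nz.
- by move=> P; apply: X_scale.
- by move=> P; apply: X_scale => i; rewrite ?invr_neq0 // exprVn pw invr1.
exists g; split=> // [|j]; rewrite gx /galois_scale coordsE //.
by rewrite rmorph1 mul1r.
Qed.

Section Projections.
Variable sg : box -> {rmorphism L -> L}.
Hypothesis sgE : forall s, galois_lift s (sg s).

(** The character by which the Galois group acts on y^b. *)
Definition chi (b : 'I_N -> nat) (s : box) : K := \prod_j (zeta ^+ s j) ^+ b j.

Lemma sg_ymon s e : sg s (ymon e) = iota (chi e s) * ymon e.
Proof.
have [_ _ sy _] := sgE s.
rewrite /ymon rmorph_prod /chi rmorph_prod -big_split; apply: eq_bigr => j _ /=.
by rewrite rmorphXn /= sy exprMn !rmorphXn.
Qed.

Lemma sg_evalx s p : sg s (evalx p) = evalx p.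
Proof.
have [sc sx _ _] := sgE s; rewrite /evalx !horner_coef rmorph_sum.
by apply: eq_bigr => i _; rewrite coef_map rmorphM rmorphXn /= sc sx.
Qed.

(** The sum over the group factors into one geometric sum for each
    coordinate. *)
Lemma chi_orthogonality (b b' : box) :
  \sum_s (chi (bexp b) s)^-1 * chi (bexp b') s = if b' == b then k%:R ^+ N else 0.
Proof.
pose om j := zeta ^+ b' j / zeta ^+ b j.
have -> : \sum_s (chi (bexp b) s)^-1 * chi (bexp b') s = \prod_(j < N) \sum_(i < k) om j ^+ i.
  rewrite bigA_distr_bigA; apply: eq_bigr => s _.
  rewrite mulrC /chi -prodf_div; apply: eq_bigr => j _.
  by rewrite exprMn exprVn -!exprM ![(s j * _)%N]mulnC.
have omk j : om j ^+ k = 1.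
  by rewrite exprMn exprVn ![(zeta ^+ _) ^+ k]exprAC (prim_expr_order zeta_prim) !expr1n invr1 mulr1.
case: eqP => [eb|/eqP ne].
  rewrite (eq_bigr (fun=> k%:R)) ?prodr_const ?card_ord // => j _.
  rewrite /om eb divff ?expf_neq0 ?zeta_neq0 //.
  by under eq_bigr do rewrite expr1n; rewrite sumr_const card_ord.
have [j bj] : exists j, b' j != b j.
  apply/existsP; apply: contraNT ne; rewrite negb_exists => /forallP h.
  by apply/eqP/ffunP => j; apply/eqP; have := h j; rewrite negbK.
apply/eqP/prodf_eq0; exists j => //.
have := subrX1 (om j) k; rewrite omk subrr => /esym/eqP.
rewrite mulf_eq0 => /orP[|//]; rewrite subr_eq0 => /eqP om1.
case/negP: bj; rewrite -val_eqE /=; rewrite -[X in X == _](modn_small (ltn_ord (b' j))) -[X in _ == X](modn_small (ltn_ord (b j))).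
rewrite -(eq_prim_root_expr zeta_prim); apply/eqP.
by rewrite -[RHS]mul1r -om1 /om divfK // expf_neq0 ?zeta_neq0.
Qed.

(** The projection to the isotypic component of chi_b. *)
Definition proj (b : box) (h : L) : L :=
  iota (k%:R ^+ N)^-1 * \sum_s iota (chi (bexp b) s)^-1 * sg s h.

Lemma projE (c : box -> L) b : (forall b' s, sg s (c b') = c b') ->
  proj b (\sum_(b' : box) ymon (bexp b') * c b') = ymon (bexp b) * c b.
Proof.
move=> hc; rewrite /proj.
under eq_bigr => s _.
  rewrite rmorph_sum mulr_sumr.
  under eq_bigr => b' _ do rewrite rmorphM /= sg_ymon hc.
  over.
rewrite exchange_big /=.
have E b' : \sum_s iota (chi (bexp b) s)^-1 * (iota (chi (bexp b') s) * ymon (bexp b') * c b') =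
   iota (if b' == b then k%:R ^+ N else 0) * (ymon (bexp b') * c b').
  rewrite -chi_orthogonality rmorph_sum mulr_suml; apply: eq_bigr => s _.
  by rewrite rmorphM /= !mulrA.
under eq_bigr do rewrite E.
rewrite (bigD1 b) //= eqxx big1 ?addr0 => [|b' /negbTE ->]; last first.
  by rewrite rmorph0 mul0r.
by rewrite mulrA -rmorphM mulVf ?expf_neq0 // rmorph1 mul1r.
Qed.

(** The projections separate the terms, and x is transcendental over K. *)
Lemma ymon_free (R : box -> {poly K}) :
  \sum_(b : box) ymon (bexp b) * evalx (R b) = 0 -> forall b, R b = 0.
Proof.
move=> E b; apply: evalx_eq0; apply: (mulfI (ymon_neq0 (bexp b))).
rewrite mulr0 -(@projE (fun b' => evalx (R b'))) => [|b' s]; last exact: sg_evalx.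
rewrite E /proj big1 ?mulr0 // => s _; by rewrite rmorph0 mulr0.
Qed.

(** * Normal forms and the derivation d/dx *)

Lemma xi_neq0 i : xi i != 0.
Proof.
elim/coord_ind: i => [||j]; [|exact: x_neq0|exact: y_neq0].
by rewrite xi0 oner_neq0.
Qed.

(** The tangent vector field: the coordinates of d/dx applied to
    (1, x, y_2, ..., y_n). *)
Definition eta : 'I_N.+2 -> L := coords 0 1 (fun j => - (x / y j) ^+ k.-1).

Lemma eta_y j : y j ^+ k.-1 * eta (iy j) = - x ^+ k.-1.
Proof.
by rewrite /eta coordsy mulrN exprMn exprVn mulrCA mulfV ?mulr1 ?expf_neq0 ?y_neq0.
Qed.

(** The logarithmic derivative of y^e along the vector field. *)
Definition dlog (e : 'I_N -> nat) : L := \sum_j (e j)%:R * (eta (iy j) / y j).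

Lemma dlogD e e' : dlog (fun j => e j + e' j)%N = dlog e + dlog e'.
Proof.
by rewrite /dlog -big_split; apply: eq_bigr => j _ /=; rewrite natrD mulrDl.
Qed.

Lemma ymonD e e' : ymon (fun j => e j + e' j)%N = ymon e * ymon e'.
Proof.
by rewrite /ymon -big_split; apply: eq_bigr => j _ /=; rewrite exprD.
Qed.

Lemma evalxD p q : evalx (p + q) = evalx p + evalx q.
Proof. by rewrite /evalx rmorphD hornerD. Qed.

Lemma evalxM p q : evalx (p * q) = evalx p * evalx q.
Proof. by rewrite /evalx rmorphM hornerM. Qed.

Lemma evalxN p : evalx (- p) = - evalx p.
Proof. by rewrite /evalx rmorphN hornerN. Qed.

Lemma evalxC c : evalx c%:P = iota c.
Proof. by rewrite /evalx map_polyC hornerC. Qed.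

Lemma evalxMn p e : evalx (p *+ e) = e%:R * evalx p.
Proof. by rewrite /evalx rmorphMn hornerMn mulr_natl. Qed.

Lemma evalxXn e : evalx 'X^e = x ^+ e.
Proof. by rewrite /evalx map_polyXn hornerXn. Qed.

Lemma evalx0 : evalx 0 = 0. Proof. by rewrite /evalx rmorph0 horner0. Qed.

Lemma evalx_sum (I : Type) (r : seq I) (P : pred I) (F : I -> {poly K}) :
  evalx (\sum_(i <- r | P i) F i) = \sum_(i <- r | P i) evalx (F i).
Proof. by rewrite /evalx rmorph_sum horner_sum. Qed.

(** The derivative of y^e p(x) along the vector field. *)
Definition dterm (e : 'I_N -> nat) (p : {poly K}) : L :=
  ymon e * (evalx p^`() + evalx p * dlog e).

(** f has a normal form in the y^b whose termwise derivative is f'.  Since the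
    y^b are independent, f = 0 then forces f' = 0. *)
Definition normal_pair (f f' : L) := exists R : box -> {poly K},
  f = \sum_b ymon (bexp b) * evalx (R b) /\ f' = \sum_b dterm (bexp b) (R b).

Lemma dtermD e p q : dterm e (p + q) = dterm e p + dterm e q.
Proof. by rewrite /dterm derivD !evalxD; ring. Qed.

Lemma dterm0 e : dterm e 0 = 0.
Proof. by rewrite /dterm deriv0 !evalx0 mul0r addr0 mulr0. Qed.

Lemma normal_pairD f f' g g' :
  normal_pair f f' -> normal_pair g g' -> normal_pair (f + g) (f' + g').
Proof.
move=> [R [-> ->]] [S [-> ->]]; exists (fun b => R b + S b).
rewrite -!big_split; split; apply: eq_bigr => b _ /=; last by rewrite dtermD.
by rewrite evalxD mulrDr.
Qed.

Lemma normal_pair0 : normal_pair 0 0.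
Proof.
exists (fun=> 0); rewrite !big1 // => b _; first by rewrite dterm0.
by rewrite evalx0 mulr0.
Qed.

(** The exponent vector of y_j^k. *)
Definition unit_exp (j : 'I_N) (l : 'I_N) : nat := if l == j then k else 0%N.

Lemma ymon_unit j : ymon (unit_exp j) = y j ^+ k.
Proof.
rewrite /ymon (bigD1 j) //= big1 ?mulr1 => [|l /negbTE lj].
  by rewrite /unit_exp eqxx.
by rewrite /unit_exp lj.
Qed.

Lemma dlog_unit j : dlog (unit_exp j) = k%:R * (eta (iy j) / y j).
Proof.
rewrite /dlog (bigD1 j) //= big1 ?addr0 => [|l /negbTE lj].
  by rewrite /unit_exp eqxx.
by rewrite /unit_exp lj mul0r.
Qed.

Lemma ymon_ext e e' : e =1 e' -> ymon e = ymon e'.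
Proof. by move=> E; apply: eq_bigr => j _; rewrite E. Qed.

Lemma dlog_ext e e' : e =1 e' -> dlog e = dlog e'.
Proof. by move=> E; apply: eq_bigr => j _; rewrite E. Qed.

(** An exponent e_j >= k is lowered by replacing y_j^k with -(mu_j + x^k).
    The termwise derivative does not change, because the vector field is
    tangent to the curve: k y_j^(k-1) eta_j = - k x^(k-1). *)
Lemma normal_pair_monomial e p : normal_pair (ymon e * evalx p) (dterm e p).
Proof.
(* Induction on the degree of y^e. *)
have [w] := ubnP (\sum_j e j)%N; elim: w e p => // w IH e p hw.
have [small|/forallPn[j]] := boolP [forall j, (e j < k)%N].
  pose b : box := [ffun j => Ordinal (forallP small j)].
  have be : bexp b =1 e by move=> j; rewrite /bexp ffunE.
  exists (fun b' => if b' == b then p else 0).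
  split; rewrite (bigD1 b) //= eqxx big1 ?addr0 => [|b' /negbTE -> //].
  - by rewrite (ymon_ext be).
  - by rewrite evalx0 mulr0.
  - by rewrite /dterm (ymon_ext be) (dlog_ext be).
  - exact: dterm0.
rewrite -leqNgt => kj.
pose e' l := (e l - unit_exp j l)%N.
have Ee : e =1 (fun l => e' l + unit_exp j l)%N.
  move=> l; rewrite /e' subnK // /unit_exp; by case: eqP => // ->.
pose c : {poly K} := - ((mu j)%:P + 'X^k).
have yc : y j ^+ k = evalx c by rewrite y_pow /c evalxN evalxD evalxC evalxXn.
have -> : ymon e * evalx p = ymon e' * evalx (c * p).
  by rewrite (ymon_ext Ee) ymonD ymon_unit yc evalxM; ring.
have -> : dterm e p = dterm e' (c * p).
  rewrite /dterm (ymon_ext Ee) (dlog_ext Ee) ymonD dlogD ymon_unit dlog_unit.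
  rewrite derivM evalxD !evalxM -yc.
  have -> : evalx c^`() = - (k%:R * x ^+ k.-1).
    by rewrite /c derivN derivD derivC add0r derivXn evalxN evalxMn evalxXn.
  have -> : y j ^+ k = y j * y j ^+ k.-1 by rewrite -exprS prednK.
  have -> : x ^+ k.-1 = - (y j ^+ k.-1 * eta (iy j)) by rewrite eta_y opprK.
  by field; rewrite y_neq0.
apply: IH; rewrite ltnS in hw; apply: leq_trans hw; rewrite (bigD1 j) //= [X in (_ < X)%N](bigD1 j) //=.
have : (\sum_(i < N | i != j) e' i <= \sum_(i < N | i != j) e i)%N.
  by apply: leq_sum => i _; apply: leq_subr.
have : (e' j < e j)%N by rewrite /e' /unit_exp eqxx ltn_subrL k_gt0 (leq_trans k_gt0).
by move=> h1 h2; rewrite -addSn leq_add.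
Qed.

Definition dform (G : {mpoly K[N.+2]}) : L :=
  \sum_i eta i * mmap iota xi G^`M(i).

Lemma dformC c : dform c%:MP = 0.
Proof. by rewrite /dform big1 // => i _; rewrite mderivC mmap0 mulr0. Qed.

Lemma dformB : {morph dform : G H / G - H}.
Proof.
move=> G H; rewrite /dform -sumrB; apply: eq_bigr => i _.
by rewrite mderivB mmapB mulrBr.
Qed.

Lemma dformM G H :
  dform (G * H) = mmap iota xi G * dform H + mmap iota xi H * dform G.
Proof.
rewrite /dform !mulr_sumr -big_split; apply: eq_bigr => i _ /=.
by rewrite mderivM rmorphD !rmorphM /=; ring.
Qed.

Lemma mmap1_coords u : mmap1 xi u = x ^+ u i1 * ymon (fun j => u (iy j)).
Proof. by rewrite /mmap1 big_coords /= xi0 expr1n mul1r. Qed.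

(** Each coordinate function is invertible in L, so the derivative of a monomial
    is the monomial times its logarithmic derivative. *)
Lemma dform_monomial c u :
  dform (c *: 'X_[u]) = dterm (fun j => u (iy j)) (c *: 'X^(u i1)).
Proof.
have E i : mmap iota xi ('X_[u])^`M(i) = mmap1 xi u * ((u i)%:R / xi i).
  rewrite mderivX mmapZ mmapX rmorph_nat.
  have [->|ui] := eqVneq (u i) 0%N; first by rewrite !mul0r mulr0.
  have -> : mmap1 xi u = mmap1 xi (u - U_(i))%MM * xi i.
    rewrite -(mmap1U xi i) -commr_mmap1_M => [|j z]; last exact: mulrC.
    by rewrite submK // lep1mP.
  by field; rewrite xi_neq0.
rewrite /dform; under eq_bigr => i _ do rewrite mderivZ mmapZ E.
rewrite big_coords /= {1 2}/eta !coordsE mul0r add0r mul1r mmap1_coords.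
rewrite /dterm /dlog -!mul_polyC derivM derivC mul0r add0r derivXn !evalxM !evalxC evalxMn !evalxXn.
have -> : \sum_(j < N) eta (iy j) * (iota c * (x ^+ u i1 * ymon (fun j0 => u (iy j0))
     * ((u (iy j))%:R / y j))) =
  iota c * x ^+ u i1 * ymon (fun j0 => u (iy j0)) *
    \sum_(j < N) (u (iy j))%:R * (eta (iy j) / y j).
  by rewrite mulr_sumr; apply: eq_bigr => j _; ring.
case: (u i1) => [|l] /=; first by rewrite !mul0r !mulr0; ring.
by rewrite exprS; field; rewrite x_neq0.
Qed.

Lemma normal_pair_form G : normal_pair (mmap iota xi G) (dform G).
Proof.
have dformD : {morph dform : F H / F + H}.
  by move=> F H; rewrite /dform -big_split; apply: eq_bigr => i _;
    rewrite mderivD mmapD mulrDr.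
elim/mpolyind: G => [|c u G _ _ IH].
  by rewrite mmap0 -(mpolyC0 N.+2 K) dformC; apply: normal_pair0.
rewrite dformD mmapD; apply: normal_pairD IH.
rewrite dform_monomial mmapZ mmapX mmap1_coords.
have -> : iota c * (x ^+ u i1 * ymon (fun j => u (iy j))) =
    ymon (fun j => u (iy j)) * evalx (c *: 'X^(u i1)).
  by rewrite -mul_polyC evalxM evalxC evalxXn; ring.
exact: normal_pair_monomial.
Qed.

Lemma dform_vanish G : mmap iota xi G = 0 -> dform G = 0.
Proof.
move=> G0; have [R [E ->]] := normal_pair_form G.
have /ymon_free R0 : \sum_b ymon (bexp b) * evalx (R b) = 0 by rewrite -E.
by rewrite big1 // => b _; rewrite R0 dterm0.
Qed.

Lemma derivation_exists : exists2 D : L -> L^o, is_derivation iota D & D x = 1.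
Proof.
have [D [hD DE]] := quotient_derivation hL dformC dformB dformM dform_vanish.
exists D => //; rewrite DE.
have E i : dform 'X_i = eta i.
  rewrite /dform (bigD1 i) //= big1 => [|l li].
    have E0 : (U_(i) - U_(i))%MM = 0%MM by apply/mnmP => l; rewrite mnmBE subnn mnm0E.
    by rewrite mderivX E0 mnm1E eqxx scale1r mmapX mmap11 mulr1 addr0.
  by rewrite mderivX mnm1E eq_sym (negbTE li) scale0r mmap0 mulr0.
by rewrite !E /eta -/i0 !coordsE mulr0 subr0.
Qed.

(** * Decomposition of rational functions *)

Lemma sg_mmap s G :
  sg s (mmap iota xi G) = mmap iota xi (rescale (galois_scale s) G).
Proof.
have [sc sx sy _] := sgE s; rewrite mmap_rescale /mmap rmorph_sum.
apply: eq_bigr => u _; rewrite rmorphM /= sc; congr (_ * _).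
rewrite /mmap1 rmorph_prod; apply: eq_bigr => i _; rewrite rmorphXn /=.
congr (_ ^+ _); elim/coord_ind: i => [||j]; rewrite /galois_scale coordsE.
- by rewrite xi0 !rmorph1 mul1r.
- by rewrite sx rmorph1 mul1r.
- exact: sy.
Qed.

Lemma mmap_normal G : exists R : box -> {poly K},
  mmap iota xi G = \sum_b ymon (bexp b) * evalx (R b).
Proof. by have [R [-> _]] := normal_pair_form G; exists R. Qed.

Definition box_add (t s : box) : box :=
  [ffun j => Ordinal (ltn_pmod (s j + t j) k_gt0)].

Lemma box_add_inj t : injective (box_add t).
Proof.
move=> s s' /ffunP E; apply/ffunP => j; apply: val_inj.
have := congr1 val (E j); rewrite !ffunE /= => /eqP.
by rewrite eqn_modDr !modn_small // => /eqP.
Qed.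

Lemma galois_scale_add t s i :
  galois_scale (box_add t s) i = galois_scale s i * galois_scale t i.
Proof.
elim/coord_ind: i => [||j]; rewrite /galois_scale !coordsE ?mulr1 //.
by rewrite ffunE /= (prim_expr_mod zeta_prim) exprD.
Qed.

(** The norm is Galois invariant, so it equals its projection to the trivial
    character, which is a polynomial in x. *)
Lemma norm_in_Kx (H : {mpoly K[N.+2]}) :
  exists v, \prod_s sg s (mmap iota xi H) = evalx v.
Proof.
set Nm := \prod_s _.
have inv t : sg t Nm = Nm.
  rewrite /Nm rmorph_prod [RHS](reindex_inj (@box_add_inj t)) /=.
  apply: eq_bigr => s _; rewrite !sg_mmap !mmap_rescale.
  by rewrite /mmap; apply: eq_bigr => u _; congr (_ * _); apply: mmap1_eq => i;
     rewrite galois_scale_add rmorphM mulrA.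
have [R E] : exists R : box -> {poly K}, Nm = \sum_b ymon (bexp b) * evalx (R b).
  have -> : Nm = mmap iota xi (\prod_s rescale (galois_scale s) H).
    by rewrite rmorph_prod; apply: eq_bigr => s _; apply: sg_mmap.
  exact: mmap_normal.
(* The zero exponent vector, which is the trivial character. *)
pose z : box := [ffun=> Ordinal k_gt0].
have z0 : bexp z =1 fun=> 0%N by move=> j; rewrite /bexp ffunE.
exists (R z).
have := projE z (c := fun b => evalx (R b)) (fun b s => sg_evalx s (R b)).
rewrite -E (ymon_ext z0) /ymon [in RHS]big1 ?mul1r // => <-.
rewrite /proj (eq_bigr (fun=> Nm)) => [|s _]; last first.
  rewrite inv /chi big1 ?invr1 ?rmorph1 ?mul1r // => j _.
  by rewrite z0 expr0.
have card_box : #|{: box}| = (k ^ N)%N by rewrite card_ffun !card_ord.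
rewrite sumr_const card_box.
have -> : Nm *+ (k ^ N) = iota (k%:R ^+ N) * Nm.
  by rewrite -natrX rmorph_nat mulr_natl.
by rewrite mulrA -rmorphM mulVf ?expf_neq0 // rmorph1 mul1r.
Qed.

(** Multiplying numerator and denominator by the other conjugates of the
    denominator replaces the denominator with its norm. *)
Lemma function_decomposition (h : L) :
  exists v (R : box -> {poly K}), v != 0 /\
    h = (\sum_b ymon (bexp b) * evalx (R b)) / evalx v.
Proof.
have [_ _ /(_ h)[e [G [H [_ _ nH ->]]]]] := hL.
have [v Ev] := norm_in_Kx H.
pose z : box := [ffun=> Ordinal k_gt0].
(* Here z is the identity of the Galois group. *)
have sgz : sg z (mmap iota xi H) = mmap iota xi H.
  rewrite sg_mmap mmap_rescale; rewrite /mmap; apply: eq_bigr => u _.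
  congr (_ * _); apply: mmap1_eq => i.
  elim/coord_ind: i => [||j]; rewrite /galois_scale coordsE ?rmorph1 ?mul1r //.
  by rewrite ffunE expr0 rmorph1 mul1r.
pose H' := \prod_(s | s != z) rescale (galois_scale s) H.
have E : evalx v = mmap iota xi H * mmap iota xi H'.
  rewrite -Ev (bigD1 z) //= sgz; congr (_ * _); rewrite rmorph_prod.
  by apply: eq_bigr => s _; apply: sg_mmap.
have nv : evalx v != 0.
  by rewrite -Ev; apply/prodf_neq0 => s _; rewrite fmorph_eq0.
have [R ER] := mmap_normal (G * H').
exists v, R; split; first by apply: contraNneq nv => ->; rewrite evalx0.
rewrite -ER E rmorphM invfM mulrACA divff ?mulr1 //.
by move: nv; rewrite E mulf_eq0 negb_or => /andP[].
Qed.

(** * Regularity of m-differentials in terms of functions *)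

Section Differentials.
Variables (Omega : lmodType L) (d : L -> Omega).
Hypothesis hOmega : is_kaehler iota d.
Variables (m : nat) (T : lmodType L) (tens : {ffun 'I_m -> Omega} -> T).
Hypothesis hT : is_tensor_power tens.

Let hd : is_derivation iota d := proj1 hOmega.
Let htens : multilinear tens := proj1 hT.
Let reg P f := regular_at iota xi P f.
Let tdx : T := tens [ffun => d x].

Lemma eta_neq0 j : eta (iy j) != 0.
Proof.
by rewrite /eta coordsy oppr_eq0 expf_neq0 // mulf_neq0 ?invr_neq0 ?x_neq0 ?y_neq0.
Qed.

Lemma d_y j : d (y j) = eta (iy j) *: d x.
Proof.
have := congr1 d (fermat_relation j).
rewrite -(rmorph0 iota) (derivationC hd) !(derivationD hd) (derivationC hd) add0r.
rewrite !(derivationXn hd) => /eqP; rewrite addrC addr_eq0 -scaleNr => /eqP E.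
have nz : k%:R * y j ^+ k.-1 != 0 by rewrite mulf_neq0 ?iota_k_neq0 ?expf_neq0 ?y_neq0.
apply: (scalerI nz); rewrite E scalerA; congr (_ *: _).
by rewrite -mulrA eta_y mulrN.
Qed.

(** This is the span argument with the whole field as O. *)
Lemma d_generated f : exists c, d f = c *: d x.
Proof.
have [_ _ /(_ f)[e [G [H [_ _ nH ->]]]]] := hL.
have hxi i : in_span d (fun=> True) (d x) (xi i).
  split=> //; elim/coord_ind: i => [||j].
  - by exists 0; rewrite // xi0 (derivation1 hd) scale0r.
  - by exists 1; rewrite // scale1r.
  - by exists (eta (iy j)); rewrite // d_y.
have hmm F : in_span d (fun=> True) (d x) (mmap iota xi F).
  exact: (in_span_mmap hd).
have [_ [c _ E]] : in_span d (fun=> True) (d x) (mmap iota xi G / mmap iota xi H).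
  by apply: (in_spanM hd) => //; apply: (in_spanV hd).
by exists c.
Qed.

Lemma tdx_generated : (forall w, exists h, w = h *: tdx) /\
  (forall h, h *: tdx = 0 -> h = 0).
Proof.
have [D hD Dx] := derivation_exists.
have [phi phix hphi] := kaehler_generated hOmega hD Dx d_generated.
exact: tensor_power_generated hT phix hphi.
Qed.

Lemma tdx_inj g h : g *: tdx = h *: tdx -> g = h.
Proof.
move=> /eqP; rewrite -subr_eq0 -scalerBl => /eqP /(proj2 tdx_generated) /eqP.
by rewrite subr_eq0 => /eqP.
Qed.

(** Regularity of h dx^m in terms of a local parameter t with dt = c dx. *)
Lemma stalk_parameter P t c h : X P -> reg P t -> d t = c *: d x -> c != 0 ->
  (forall f, reg P f -> exists2 g, reg P g & d f = g *: d t) ->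
  mdiff_regular_at iota xi d tens P (h *: tdx) <-> reg P (h / c ^+ m).
Proof.
move=> XP Ot dt nc gen; rewrite (stalk_generated hL htens XP Ot gen).
have E : tens [ffun => d t] = c ^+ m *: tdx.
  by rewrite dt (multilinear_scale_cst htens).
have ncm : c ^+ m != 0 by rewrite expf_neq0.
split=> [[g Og]|Oh].
  by rewrite E scalerA => /tdx_inj ->; rewrite mulfK.
by exists (h / c ^+ m) => //; rewrite E scalerA divfK.
Qed.

Lemma regular_unitM P u c f : X P -> has_value iota xi P u c -> c != 0 ->
  reg P (f * u) <-> reg P f.
Proof.
move=> XP hu nc; split=> Of; last exact: regularM Of (has_value_regular hu).
have nu : u != 0.
  apply: contraNneq nc => u0; rewrite u0 in hu.
  by rewrite (has_value_uniq hL XP hu (has_value0 _ _ _)).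
rewrite -(mulfK nu f); apply: regularM Of _.
exact: regularV hu nc.
Qed.

(** The product of all y_j^(m(k-1)): up to units, the factor between dx^m and
    dt^m at an affine point with local parameter t. *)
Definition ytop : L := ymon (fun=> m * k.-1)%N.

Lemma has_value_y P j : P i0 != 0 ->
  has_value iota xi P (y j) (P (iy j) / P i0).
Proof. exact: has_value_affine. Qed.

(** This is where the mu_j have to be distinct. *)
Lemma affine_two_zeros P j l : X P -> P i0 != 0 -> P (iy j) = 0 ->
  P (iy l) = 0 -> l = j.
Proof.
move=> /XE[_ hP] P0 Pj Pl; apply: mu_inj; apply: (mulIf (expf_neq0 k P0)).
have := hP j; have := hP l; rewrite Pj Pl expr0n (gtn_eqF k_gt0) !addr0 => <-.
by move=> /(can_inj (addrK _)).
Qed.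

Lemma affine_zero_x P j : X P -> P i0 != 0 -> P (iy j) = 0 -> P i1 != 0.
Proof.
move=> /XE[_ /(_ j) +] P0 Pj; rewrite Pj expr0n (gtn_eqF k_gt0) addr0 => E.
apply: contra_eq_neq E => ->; rewrite expr0n (gtn_eqF k_gt0) addr0.
by rewrite mulf_neq0 ?expf_neq0.
Qed.

Lemma d_regular_affine P w : X P -> P i0 != 0 ->
  (exists2 g, reg P g & d x = g *: w) ->
  (forall j, exists2 g, reg P g & d (y j) = g *: w) ->
  forall f, reg P f -> exists2 g, reg P g & d f = g *: w.
Proof.
move=> XP P0 hx hy; apply: (d_regular hL hd XP P0) => i.
rewrite xi0 divr1; elim/coord_ind: i => [|//|//].
exists 0; first exact: has_value_regular (has_value0 _ _ _).
by rewrite xi0 (derivation1 hd) scale0r.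
Qed.

Lemma regular_eta P j : X P -> P i0 != 0 -> P (iy j) != 0 -> reg P (eta (iy j)).
Proof.
move=> XP P0 Pj; rewrite /eta coordsy; apply/regularN/regularX.
apply: regularM; first exact: has_value_regular (has_value_affine i1 P0).
by apply: regularV (has_value_y j P0) _; rewrite mulf_neq0 ?invr_neq0.
Qed.

(** The local parameter is x where no y_j vanishes and y_j where y_j vanishes;
    in the second case dx = -(y_j / x)^(k-1) dy_j. *)
Lemma stalk_affine P h : X P -> P i0 != 0 ->
  mdiff_regular_at iota xi d tens P (h *: tdx) <-> reg P (h * ytop).
Proof.
move=> XP P0.
have [/forallP nzy|/forallPn[j /negPn/eqP Pj]] := boolP [forall j, P (iy j) != 0].
  rewrite (@stalk_parameter P x 1) ?oner_neq0 ?scale1r //.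
  - rewrite expr1n divr1 (regular_unitM _ XP (u := ytop)
       (c := \prod_j (P (iy j) / P i0) ^+ (m * k.-1))) //.
      by apply: has_value_prod => j; apply: has_valueX; apply: has_value_y.
    by apply/prodf_neq0 => j _; rewrite expf_neq0 // mulf_neq0 ?invr_neq0.
  - exact: has_value_regular (has_value_affine i1 P0).
  apply: d_regular_affine => // [|j].
    by exists 1; rewrite ?scale1r //; apply: has_value_regular (has_value1 _ _ _).
  by exists (eta (iy j)); [exact: regular_eta | exact: d_y].
have P1 := affine_zero_x XP P0 Pj.
have nzy l : l != j -> P (iy l) != 0.
  by apply: contraNneq => Pl; rewrite (affine_two_zeros XP P0 Pj Pl).
have dxE : d x = (eta (iy j))^-1 *: d (y j).
  by rewrite d_y scalerA mulVf ?eta_neq0 // scale1r.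
have Oinv : reg P (eta (iy j))^-1.
  rewrite /eta coordsy invrN; apply: regularN; rewrite -exprVn; apply: regularX.
  rewrite invf_div; apply: regularM.
    exact: has_value_regular (has_value_y j P0).
  by apply: regularV (has_value_affine i1 P0) _; rewrite mulf_neq0 ?invr_neq0.
rewrite (stalk_parameter h XP (has_value_regular (has_value_y j P0)) (d_y j)
  (eta_neq0 j)); last first.
  apply: d_regular_affine => // [|l]; first by exists (eta (iy j))^-1.
  have [->|lj] := eqVneq l j.
    by exists 1; rewrite ?scale1r //; apply: has_value_regular (has_value1 _ _ _).
  exists (eta (iy l) * (eta (iy j))^-1); last by rewrite d_y dxE scalerA.
  by apply: regularM Oinv; apply: regular_eta => //; apply: nzy.
pose u := (- x ^+ k.-1) ^+ m * \prod_(l | l != j) y l ^+ (m * k.-1).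
have -> : h * ytop = h / eta (iy j) ^+ m * u.
  rewrite /ytop /ymon (bigD1 j) //= /u -(eta_y j) exprMn -exprM.
  by rewrite [(k.-1 * m)%N]mulnC; field; rewrite expf_neq0 ?eta_neq0.
symmetry; apply: (regular_unitM _ XP (u := u) (c :=
  (- (P i1 / P i0) ^+ k.-1) ^+ m * \prod_(l | l != j) (P (iy l) / P i0) ^+ (m * k.-1))).
  apply: has_valueM.
    by apply/has_valueX/has_valueN/has_valueX/has_value_affine.
  rewrite big_mkcond [X in has_value _ _ _ _ X]big_mkcond; apply: has_value_prod => l.
  case: eqP => _ /=; first exact: has_value1.
  by apply/has_valueX/has_value_y.
rewrite mulf_neq0 ?expf_neq0 ?oppr_eq0 ?expf_neq0 ?mulf_neq0 ?invr_neq0 //.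
by apply/prodf_neq0 => l lj; rewrite expf_neq0 // mulf_neq0 ?invr_neq0 ?nzy.
Qed.

Lemma has_value_xinv P : X P -> P i0 = 0 -> has_value iota xi P x^-1 0.
Proof.
move=> XP P0; have := has_value_coord iota xi i0 (infinity_coord1 XP P0).
by rewrite xi0 mul1r P0 mul0r.
Qed.

(** The local parameter is t = 1/x, with dx = - x^2 dt.  The differential of
    y_j / x simplifies by the equation of the curve to
    - mu_j (y_j / x)^(1-k) t^(k-1) dt. *)
Lemma stalk_infinity P h : X P -> P i0 = 0 ->
  mdiff_regular_at iota xi d tens P (h *: tdx) <-> reg P (h * x ^+ (2 * m)).
Proof.
move=> XP P0; have P1 := infinity_coord1 XP P0.
have nx := x_neq0; have Ot := has_value_regular (has_value_xinv XP P0).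
have dt : d x^-1 = - x ^- 2 *: d x by rewrite (derivationV hd).
have dxE : d x = - x ^+ 2 *: d x^-1.
  by rewrite dt scalerA mulrNN mulfV ?scale1r // expf_neq0.
have nc : - x ^- 2 != 0 by rewrite oppr_eq0 invr_neq0 // expf_neq0.
rewrite (stalk_parameter _ XP Ot dt nc); last first.
  apply: (d_regular hL hd XP P1) => i; elim/coord_ind: i => [||j].
  - exists 1; last by rewrite xi0 mul1r scale1r.
    exact: has_value_regular (has_value1 _ _ _).
  - exists 0; first exact: has_value_regular (has_value0 _ _ _).
    by rewrite divff // (derivation1 hd) scale0r.
  exists (- iota (mu j) * (y j / x)^-1 ^+ k.-1 * x^-1 ^+ k.-1).
    apply: regularM; last exact: regularX.
    apply: regularM; first by rewrite -rmorphN; apply: regular_const.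
    apply/regularX; apply: regularV (has_value_coord iota xi (iy j) P1) _.
    by rewrite mulf_neq0 ?invr_neq0 // infinity_coordy.
  rewrite (derivationM hd) d_y dxE !scalerA -scalerDl; congr (_ *: _).
  have ny := y_neq0 j.
  have Emu : - iota (mu j) = y j * y j ^+ k.-1 + x * x ^+ k.-1.
    by rewrite -!exprS !prednK // y_pow; ring.
  rewrite Emu /eta coordsy.
  rewrite !exprVn !exprMn !exprVn; field.
  by rewrite nx !expf_neq0.
have -> : h / (- x ^- 2) ^+ m = h * x ^+ (2 * m) * (-1) ^+ m.
  rewrite -exprVn invrN invrK exprM [in RHS]mulrAC -mulrA.
  by rewrite -[- x ^+ 2]mulN1r exprMn; ring.
have nm1 : (-1) ^+ m != 0 :> K by rewrite expf_neq0 // oppr_eq0 oner_neq0.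
apply: (regular_unitM _ XP _ nm1).
by rewrite -[-1]/(- 1) -(rmorph1 iota) -rmorphN; apply/has_valueX/has_value_const.
Qed.

(** The conditions on h which express that h dx^m is a global section. *)
Definition global_function (h : L) : Prop :=
  (forall P, X P -> P i0 != 0 -> reg P (h * ytop)) /\
  (forall P, X P -> P i0 = 0 -> reg P (h * x ^+ (2 * m))).

Lemma global_mdiffE h :
  global_mdiff X iota xi d tens (h *: tdx) <-> global_function h.
Proof.
split=> [g|[ga gi] P XP].
  split=> P XP P0; first by apply/(stalk_affine h XP P0)/g.
  by apply/(stalk_infinity h XP P0)/g.
have [P0|P0] := eqVneq (P i0) 0; first by apply/(stalk_infinity h XP P0)/gi.
by apply/(stalk_affine h XP P0)/ga.
Qed.

(** * The components of a global m-differential *)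

(** An average of conjugates is regular at P if the function is regular at all
    conjugates of P. *)
Lemma proj_regular P f b : X P ->
  (forall s, reg (fun i => galois_scale s i * P i) f) -> reg P (proj b f).
Proof.
move=> XP Of; rewrite /proj; apply: regularM; first exact: regular_const.
apply: (regular_sum hL XP) => s; apply: regularM; first exact: regular_const.
have [_ _ _ sv] := sgE s; have [c hc] := (regular_atP _ _ _ _).1 (Of s).
exact: has_value_regular (sv _ _ _ XP hc).
Qed.

Lemma X_galois s P : X P -> X (fun i => galois_scale s i * P i).
Proof. by apply: X_scale; [exact: galois_scale_neq0|exact: galois_scale_pow]. Qed.

(** At a point with y_j = 0 the equation gives
    y_j^k = -(x^k - x_0^k) = -(x - x_0) S, where S has the nonzero value
    k x_0^(k-1) and the exponent of y_j in y^b is less than k. *)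
Lemma x_shift_vanishes P (b : box) : X P -> P i0 = 1 ->
  has_value iota xi P ((x - iota (P i1)) / ymon (bexp b)) 0.
Proof.
move=> XP P0; have P0nz : P i0 != 0 by rewrite P0 oner_neq0.
have hy l : has_value iota xi P (y l) (P (iy l)).
  by have := has_value_y l P0nz; rewrite P0 divr1.
have hx : has_value iota xi P x (P i1).
  by have := has_value_affine i1 P0nz; rewrite P0 divr1.
have [/forallP nzy|/forallPn[j /negPn/eqP Pj]] := boolP [forall j, P (iy j) != 0].
  have -> : 0 = (P i1 - P i1) * (\prod_l P (iy l) ^+ bexp b l)^-1.
    by rewrite subrr mul0r.
  apply: has_valueM.
    by apply: (has_valueD hL XP hx); apply: has_valueN; apply: has_value_const.
  apply: has_valueV; first by apply: has_value_prod => l; apply: has_valueX.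
  by apply/prodf_neq0 => l _; rewrite expf_neq0.
have P1 := affine_zero_x XP P0nz Pj.
have nzy l : l != j -> P (iy l) != 0.
  by apply: contraNneq => Pl; rewrite (affine_two_zeros XP P0nz Pj Pl).
have Emu : iota (mu j) = - iota (P i1) ^+ k.
  move/XE: (XP) => [_ /(_ j)]; rewrite P0 Pj expr1n mulr1 expr0n (gtn_eqF k_gt0).
  by rewrite addr0 => /eqP; rewrite addr_eq0 => /eqP ->; rewrite rmorphN rmorphXn.
pose S := \sum_(i < k) x ^+ (k.-1 - i) * iota (P i1) ^+ i.
have hS : has_value iota xi P S (k%:R * P i1 ^+ k.-1).
  have -> : k%:R * P i1 ^+ k.-1 = \sum_(i < k) P i1 ^+ (k.-1 - i) * P i1 ^+ i.
    rewrite (eq_bigr (fun=> P i1 ^+ k.-1)) => [|i _].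
      by rewrite sumr_const card_ord mulr_natl.
    by rewrite -exprD subnK // -ltnS prednK.
  apply: (has_value_sum hL XP) => i; apply: has_valueM; apply: has_valueX => //.
  exact: has_value_const.
have nS : k%:R * P i1 ^+ k.-1 != 0 by rewrite mulf_neq0 ?expf_neq0.
have nSL : S != 0.
  apply: contraNneq nS => S0; rewrite S0 in hS.
  by rewrite (has_value_uniq hL XP hS (has_value0 _ _ _)).
have Ek : y j ^+ k = - ((x - iota (P i1)) * S).
  rewrite y_pow Emu /S; have := subrXX x (iota (P i1)) k.
  rewrite (eq_bigr (fun i : 'I_k => x ^+ (k.-1 - i) * iota (P i1) ^+ i)) => [<-|i _].
    by rewrite opprD opprK opprB addrC.
  by rewrite -subn1 -subnDA add1n.
pose U := S * \prod_(l | l != j) y l ^+ bexp b l.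
have bj : (bexp b j < k)%N by exact: ltn_ord.
have nyj := y_neq0 j.
have -> : (x - iota (P i1)) / ymon (bexp b) = - y j ^+ (k - bexp b j) * U^-1.
  rewrite /ymon (bigD1 j) //= /U; set Pi := \prod_(_ < _ | _) _.
  have nPi : Pi != 0 by apply/prodf_neq0 => l _; rewrite expf_neq0 ?y_neq0.
  have Ek2 : y j ^+ (k - bexp b j) = - ((x - iota (P i1)) * S) / y j ^+ bexp b j.
    by rewrite -Ek -{2}(subnK (ltnW bj)) exprD mulfK // expf_neq0.
  by rewrite Ek2; field; rewrite nSL nPi expf_neq0.
have -> : 0 = - P (iy j) ^+ (k - bexp b j) *
     (k%:R * P i1 ^+ k.-1 * \prod_(l | l != j) P (iy l) ^+ bexp b l)^-1.
  by rewrite Pj expr0n subn_eq0 leqNgt bj oppr0 mul0r.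
apply: has_valueM; first by apply/has_valueN/has_valueX.
apply: has_valueV.
  apply: has_valueM => //.
  rewrite big_mkcond [X in has_value _ _ _ _ X]big_mkcond; apply: has_value_prod => l.
  case: eqP => _ /=; first exact: has_value1.
  exact: has_valueX.
rewrite mulf_neq0 //; apply/prodf_neq0 => l lj.
by rewrite expf_neq0 ?nzy.
Qed.

(** In lowest terms r_1 / v_1, a root x_0 of v_1 = v_2 (x - x_0) would give
    r_1 = v_2 * ((x - x_0) / y^b) * (y^b r_1 / v_1), whose second factor
    vanishes over x_0; but r_1(x_0) is nonzero. *)
Lemma component_polynomial (b : box) (r v : {poly K}) : v != 0 ->
  (forall P, X P -> P i0 != 0 -> reg P (ymon (bexp b) * (evalx r / evalx v))) ->
  exists q, evalx r / evalx v = evalx q.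
Proof.
move=> nv Oall; pose g := gcdp r v.
have ng : g != 0 by rewrite gcdp_eq0 negb_and nv orbT.
pose r1 := r %/ g; pose v1 := v %/ g.
have Er : r = r1 * g by rewrite divpK ?dvdp_gcdl.
have Ev : v = v1 * g by rewrite divpK ?dvdp_gcdr.
have evalx_neq0 p : p != 0 -> evalx p != 0 by apply: contraNneq => /evalx_eq0 ->.
have nv1 : v1 != 0 by apply: contraNneq nv => E; rewrite Ev E mul0r.
have cop : coprimep r1 v1 by apply: coprimep_div_gcd; rewrite nv orbT.
have Efrac : evalx r / evalx v = evalx r1 / evalx v1.
  by rewrite {1}Er {1}Ev !evalxM; field; rewrite !evalx_neq0.
have [/eqP/size_poly1P[c nc Ec]|/closed_rootP[x0 rx0]] := eqVneq (size v1) 1%N.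
  exists (c^-1 *: r1); rewrite Efrac Ec evalxC -mul_polyC evalxM evalxC fmorphV.
  by rewrite mulrC.
have r1x0 : r1.[x0] != 0 by apply: coprimep_root rx0; rewrite coprimep_sym.
have [P [XP P0 P1]] := affine_point x0.
have P0nz : P i0 != 0 by rewrite P0 oner_neq0.
move: rx0 => /factor_theorem[v2 Ev2].
have := Oall P XP P0nz; rewrite Efrac => /regular_atP[c hc].
have hz := x_shift_vanishes b XP P0.
have h2 := has_value_evalx v2 XP P0nz.
have := has_valueM (has_valueM h2 hz) hc; rewrite mulr0 mul0r.
have -> : evalx v2 * ((x - iota (P i1)) / ymon (bexp b)) *
    (ymon (bexp b) * (evalx r1 / evalx v1)) = evalx r1.
  have Ev1 : evalx v1 = evalx v2 * (x - iota (P i1)).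
    by rewrite Ev2 evalxM P1 /evalx rmorphB /= map_polyX map_polyC !hornerE.
  have := evalx_neq0 _ nv1; rewrite Ev1 mulf_eq0 negb_or => /andP[n2 nx].
  by field; rewrite ymon_neq0 n2 nx.
move=> h0; have := has_value_evalx r1 XP P0nz; rewrite P0 P1 divr1 => h1.
by move: r1x0; rewrite (has_value_uniq hL XP h1 h0) eqxx.
Qed.

Lemma affine_components h :
  (forall P, X P -> P i0 != 0 -> reg P (h * ytop)) ->
  exists Q : box -> {poly K}, h * ytop = \sum_b ymon (bexp b) * evalx (Q b).
Proof.
move=> Oh; have [v [R [nv E]]] := function_decomposition (h * ytop).
have {}E : h * ytop = \sum_b ymon (bexp b) * (evalx (R b) / evalx v).
  by rewrite E mulr_suml; apply: eq_bigr => b _; rewrite mulrA.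
have [Q hQ] : exists Q : box -> {poly K}, forall b, evalx (R b) / evalx v = evalx (Q b).
  apply: (@fin_all_exists _ _ (fun b q => evalx (R b) / evalx v = evalx q)) => b.
  apply: (component_polynomial nv (b := b)) => P XP P0.
  have <- : proj b (h * ytop) = ymon (bexp b) * (evalx (R b) / evalx v).
    rewrite E (projE b (c := fun b => evalx (R b) / evalx v)) // => b' s.
    by rewrite fmorph_div !sg_evalx.
  apply: proj_regular => // s; apply: Oh; first exact: X_galois.
  by rewrite mulf_neq0 ?galois_scale_neq0.
by exists Q; rewrite E; apply: eq_bigr => b _; rewrite hQ.
Qed.

(** * The order at the points at infinity *)

(** A positive power of x is not regular at infinity: its product with the same
    power of 1/x, which vanishes there, is 1. *)
Lemma x_power_regular P p q : X P -> P i0 = 0 ->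
  reg P (x ^+ p / x ^+ q) <-> (p <= q)%N.
Proof.
move=> XP P0; have hxi := has_value_xinv XP P0; have nx := x_neq0.
split=> [|pq]; last first.
  rewrite -(subnK pq) exprD invfM mulrCA divff ?mulr1 ?expf_neq0 // -exprVn.
  exact: regularX (has_value_regular hxi).
rewrite leqNgt; case: ltnP => // qp /regular_atP[c hc].
have := has_valueM hc (has_valueX (p - q) hxi).
rewrite expr0n subn_eq0 leqNgt qp mulr0 => h0.
have E1 : x ^+ p / x ^+ q * x^-1 ^+ (p - q) = 1.
  by rewrite -{1}(subnK (ltnW qp)) exprD exprVn mulfK ?expf_neq0 // divff ?expf_neq0.
rewrite E1 in h0; have := has_value_uniq hL XP h0 (has_value1 _ _ _).
by move/esym/eqP; rewrite oner_eq0.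
Qed.

Definition weight (e : 'I_N -> nat) : nat := (\sum_j e j)%N.

(** The functions y_j / x are units at infinity. *)
Lemma ymon_at_infinity P e : X P -> P i0 = 0 ->
  exists2 c, c != 0 & has_value iota xi P (ymon e / x ^+ weight e) c.
Proof.
move=> XP P0; have P1 := infinity_coord1 XP P0.
exists (\prod_j (P (iy j) / P i1) ^+ e j).
  by apply/prodf_neq0 => j _; rewrite expf_neq0 // mulf_neq0 ?invr_neq0 ?infinity_coordy.
rewrite /weight -prodrXr /ymon -prodf_div.
apply: has_value_prod => j; rewrite -expr_div_n; apply: has_valueX.
exact: has_value_coord.
Qed.

Lemma evalx_at_infinity P q : X P -> P i0 = 0 ->
  has_value iota xi P (evalx q / x ^+ (size q).-1) (lead_coef q).
Proof.
move=> XP P0; have hxi := has_value_xinv XP P0; have nx := x_neq0.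
have [->|nq] := eqVneq q 0.
  by rewrite evalx0 mul0r lead_coef0; apply: has_value0.
have sz : ((size q).-1.+1 = size q)%N by rewrite prednK // size_poly_gt0.
have -> : evalx q / x ^+ (size q).-1 =
    \sum_(i < size q) iota q`_i * x^-1 ^+ ((size q).-1 - i).
  rewrite {1}/evalx horner_coef size_map_poly mulr_suml; apply: eq_bigr => i _.
  have hi : (i <= (size q).-1)%N by rewrite -ltnS sz.
  rewrite coef_map -mulrA -{1}(subnK hi) exprD exprVn.
  by congr (_ * _); field; rewrite !expf_neq0.
have -> : lead_coef q = \sum_(i < size q) q`_i * 0 ^+ ((size q).-1 - i).
  rewrite -sz big_ord_recr /= subnn expr0 mulr1 big1 ?add0r // => i _.
  by rewrite expr0n subn_eq0 leqNgt ltn_ord mulr0.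
apply: (has_value_sum hL XP) => i; apply: has_valueM; first exact: has_value_const.
exact: has_valueX.
Qed.

(** Up to a unit the function is a power of x. *)
Lemma term_at_infinity P (b : box) q : X P -> P i0 = 0 ->
  reg P (ymon (bexp b) * evalx q / ytop * x ^+ (2 * m)) <->
  q = 0 \/ ((size q).-1 + weight (bexp b) + 2 * m <= N * (m * k.-1))%N.
Proof.
move=> XP P0; have nx := x_neq0.
have wtop : weight (fun=> m * k.-1)%N = (N * (m * k.-1))%N.
  by rewrite /weight sum_nat_const card_ord.
have [->|nq] := eqVneq q 0.
  rewrite evalx0 mulr0 !mul0r; split=> _; first by left.
  exact: has_value_regular (has_value0 _ _ _).
have [cb nb hb] := ymon_at_infinity (bexp b) XP P0.
have [ct nt ht] := ymon_at_infinity (fun=> m * k.-1)%N XP P0.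
have hq := evalx_at_infinity q XP P0.
have nlq : lead_coef q != 0 by rewrite lead_coef_eq0.
have hu := has_valueM (has_valueM hb hq) (has_valueV ht nt).
set D := (size q).-1 in hq hu *.
set E := (N * (m * k.-1))%N in wtop *.
have -> : ymon (bexp b) * evalx q / ytop * x ^+ (2 * m) =
   x ^+ (D + weight (bexp b) + 2 * m) / x ^+ E *
   (ymon (bexp b) / x ^+ weight (bexp b) * (evalx q / x ^+ D) *
     (ymon (fun=> (m * k.-1)%N) / x ^+ weight (fun=> (m * k.-1)%N))^-1).
  rewrite wtop /ytop !exprD.
  by field; rewrite ymon_neq0 !expf_neq0.
rewrite (regular_unitM _ XP hu) ?mulf_neq0 ?invr_neq0 // x_power_regular //.
by split=> [|[/eqP|//]]; [right | rewrite (negbTE nq)].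
Qed.

Lemma global_functionE h : global_function h <->
  exists Q : box -> {poly K}, h = (\sum_b ymon (bexp b) * evalx (Q b)) / ytop /\
   forall b, Q b = 0 \/
    ((size (Q b)).-1 + weight (bexp b) + 2 * m <= N * (m * k.-1))%N.
Proof.
have nt : ytop != 0 by exact: ymon_neq0.
split=> [[ga gi]|[Q [-> hQ]]]; last first.
  split=> P XP P0.
    rewrite divfK //; apply: (regular_sum hL XP) => b.
    apply: regularM; last exact: has_value_regular (has_value_evalx _ XP P0).
    apply: regular_prod => j; apply: regularX.
    exact: has_value_regular (has_value_y j P0).
  rewrite !mulr_suml; apply: (regular_sum hL XP) => b.
  by apply/term_at_infinity.
have [Q EQ] := affine_components ga.
have Eh : h = (\sum_b ymon (bexp b) * evalx (Q b)) / ytop by rewrite -EQ mulfK.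
exists Q; split=> // b; have [P XP P0] := point_at_infinity.
apply/(term_at_infinity b (Q b) XP P0).
have [ct nct ht] := ymon_at_infinity (fun=> m * k.-1)%N XP P0.
set w := weight _ in ht; have nx := x_neq0.
(* The factor ytop is not Galois invariant; x^w has the same order at infinity
   and is, which allows the projection to be taken. *)
have -> : ymon (bexp b) * evalx (Q b) / ytop * x ^+ (2 * m) =
    proj b (h * ytop * (x ^+ (2 * m) / x ^+ w)) * (ytop / x ^+ w)^-1.
  rewrite EQ mulr_suml.
  under [in RHS]eq_bigr do rewrite -mulrA.
  rewrite (projE b (c := fun b => evalx (Q b) * (x ^+ (2 * m) / x ^+ w))).
    by field; rewrite nt expf_neq0.
  by move=> b' s; have [_ sx _ _] := sgE s; rewrite rmorphM sg_evalx fmorph_div !rmorphXn /= sx.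
apply: regularM; last exact: regularV ht nct.
apply: proj_regular => // s.
have XsP := X_galois s XP.
have sP0 : galois_scale s i0 * P i0 = 0 by rewrite P0 mulr0.
have [c' _ ht'] := ymon_at_infinity (fun=> m * k.-1)%N XsP sP0.
have -> : h * ytop * (x ^+ (2 * m) / x ^+ w) =
   h * x ^+ (2 * m) * (ytop / x ^+ w) by field; rewrite expf_neq0.
exact: regularM (gi _ XsP sP0) (has_value_regular ht').
Qed.

(** * The index set and the basis *)

Hypothesis m_gt0 : (0 < m)%N.

(** The change of indices a = m(k-1) - b. *)
Definition box_exponent (b : box) : {ffun 'I_N -> int} :=
  [ffun j => (m * k.-1)%:Z - (b j)%:Z].

(** The reduction modulo k makes this a total inverse; it changes nothing for
    the a in the index set. *)
Definition exponent_box (a : {ffun 'I_N -> int}) : box :=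
  [ffun j => Ordinal (ltn_pmod `|(m * k.-1)%:Z - a j|%N k_gt0)].

Lemma box_exponentK : cancel box_exponent exponent_box.
Proof.
move=> b; apply/ffunP => j; apply: val_inj; rewrite !ffunE /=.
by rewrite opprB addrC subrK ?absz_nat modn_small.
Qed.

Lemma box_le_top (b : box) j : (b j <= m * k.-1)%N.
Proof.
have : (b j <= k.-1)%N by rewrite -ltnS prednK.
by move=> h; apply: leq_trans h _; rewrite leq_pmull.
Qed.

Lemma index_setE (r : int) (a : {ffun 'I_N -> int}) :
  @index_set k N.+1 m (r, a) <-> exists e (b : box),
    [/\ r = e%:Z, a = box_exponent b
      & (e + weight (bexp b) + 2 * m <= N * (m * k.-1))%N].
Proof.
have kE : k%:Z - 1 = k.-1%:Z by lia.
have sumE (b : box) : \sum_j box_exponent b j =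
    (N * (m * k.-1))%:Z - (weight (bexp b))%:Z.
  under eq_bigr do rewrite ffunE.
  rewrite sumrB sumr_const card_ord -mulr_natl natz PoszM; congr (_ - _).
  by rewrite /weight -natz natr_sum; apply: eq_bigr => j _; rewrite natz.
rewrite /index_set /=; split=> [/andP[/forallP ha /andP[r0 hr]]|].
  pose b := exponent_box a.
  have aE : a = box_exponent b.
    apply/ffunP => j; rewrite !ffunE /=; have := ha j; rewrite kE => /andP[l u].
    have [t Et] : exists t : nat, (m * k.-1)%:Z - a j = t%:Z.
      by exists `|(m * k.-1)%:Z - a j|%N; rewrite gez0_abs // subr_ge0 PoszM.
    have tk : (t < k)%N by move: l Et kE; lia.
    by rewrite Et ?absz_nat modn_small // -Et opprB addrC subrK.
  exists `|r|%N, b; rewrite gez0_abs //; split=> //.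
  by move: hr; rewrite aE sumE; lia.
move=> [e [b [-> -> hw]]]; apply/andP; split; last by rewrite sumE; lia.
apply/forallP => j; rewrite ffunE kE.
have := ltn_ord (b j); nia.
Qed.

Definition theta_fun (ra : int * {ffun 'I_N -> int}) : L :=
  xi (inord 1) ^ ra.1 / \prod_(j < N) xi (inord j.+2) ^ ra.2 j.

Lemma thetaE ra : @theta L N.+1 m xi Omega d T tens ra = theta_fun ra *: tdx.
Proof. by case: ra => r a; rewrite /theta /theta_fun /tdx inord1E. Qed.

Lemma theta_fun_box e (b : box) :
  theta_fun (e%:Z, box_exponent b) = x ^+ e * ymon (bexp b) / ytop.
Proof.
rewrite /theta_fun /= inord1E -exprnP -mulrA; congr (_ * _).
rewrite /ymon /ytop /ymon -prodf_div -prodfV; apply: eq_bigr => j _.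
rewrite inordyE ffunE subzn ?box_le_top // -exprnP.
have nyj := y_neq0 j.
rewrite -{2}(subnK (box_le_top b j)) exprD /bexp.
by field; rewrite !expf_neq0.
Qed.

Lemma combinationE (s : seq (int * {ffun 'I_N -> int})) (c : _ -> K) :
  \sum_(j <- s) iota (c j) *: @theta L N.+1 m xi Omega d T tens j
  = (\sum_(j <- s) iota (c j) * theta_fun j) *: tdx.
Proof.
by rewrite scaler_suml; apply: eq_bigr => j _; rewrite thetaE scalerA.
Qed.

(** The terms of a linear combination of the thetas with the same y^b, collected
    into one polynomial in x. *)
Definition box_poly (s : seq (int * {ffun 'I_N -> int})) (c : _ -> K) (b : box) :
  {poly K} := \sum_(j <- s | exponent_box j.2 == b) c j *: 'X^(`|j.1|%N).

Lemma box_polyE s c : all (@index_set k N.+1 m) s ->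
  (\sum_(j <- s) iota (c j) * theta_fun j) * ytop
  = \sum_b ymon (bexp b) * evalx (box_poly s c b).
Proof.
move=> /allP hs; rewrite mulr_suml.
under [in RHS]eq_bigr do rewrite /box_poly big_mkcond evalx_sum mulr_sumr.
rewrite exchange_big /= big_seq [RHS]big_seq; apply: eq_bigr => -[r a] /hs.
move=> /index_setE[e [b [-> -> _]]].
rewrite (bigD1 b) //= box_exponentK eqxx big1 => [|b' /negbTE nb].
  rewrite addr0 theta_fun_box -mul_polyC evalxM evalxC evalxXn ?absz_nat.
  by field; exact: ymon_neq0.
by rewrite eq_sym nb evalx0 mulr0.
Qed.

Lemma theta_free s c : uniq s -> all (@index_set k N.+1 m) s ->
  \sum_(j <- s) iota (c j) *: @theta L N.+1 m xi Omega d T tens j = 0 ->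
  forall j, j \in s -> c j = 0.
Proof.
move=> us hs; rewrite combinationE => /(proj2 tdx_generated) E.
have := box_polyE c hs; rewrite E mul0r => /esym/ymon_free R0 [r a] js.
have /index_setE[e [b [Er Ea _]]] := allP hs _ js.
have := congr1 (fun p : {poly K} => p`_e) (R0 b); rewrite coef0 => <-.
rewrite /box_poly big_mkcond coef_sum (bigD1_seq (r, a)) //= big_seq_cond big1.
  by rewrite Ea box_exponentK eqxx Er ?absz_nat coefZ coefXn eqxx mulr1 addr0.
move=> [r' a'] /andP[/(allP hs)/index_setE[e' [b' [-> -> _]]]].
rewrite box_exponentK Er Ea; case: (eqVneq b' b) => [->|_ _]; last by rewrite coef0.
rewrite ?absz_nat coefZ coefXn; case: (eqVneq e e') => [->|_ _]; last by rewrite mulr0.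
by rewrite eqxx.
Qed.

Lemma theta_global ra : @index_set k N.+1 m ra -> forall c,
  global_function (iota c * theta_fun ra).
Proof.
case: ra => r a /index_setE[e [b [-> -> hw]]] c; rewrite theta_fun_box.
apply/global_functionE.
exists (fun b' => if b' == b then c *: 'X^e else 0); split.
  rewrite (bigD1 b) //= eqxx big1 ?addr0 => [|b' /negbTE ->]; last first.
    by rewrite evalx0 mulr0.
  by rewrite -mul_polyC evalxM evalxC evalxXn; field; exact: ymon_neq0.
move=> b'; case: eqP => [->|_]; last by left.
right; apply: leq_trans hw; rewrite !leq_add2r.
by rewrite -subn1 leq_subLR add1n (leq_trans (size_scale_leq _ _)) ?size_polyXn.
Qed.

Lemma global_function_sum (I : eqType) (s : seq I) (F : I -> L) :
  (forall i, i \in s -> global_function (F i)) ->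
  global_function (\sum_(i <- s) F i).
Proof.
have O0 P : reg P 0 by exact: has_value_regular (has_value0 _ _ _).
move=> hF; split=> P XP P0; rewrite mulr_suml big_seq_cond big_mkcond;
  apply: (regular_sum hL XP) => i; rewrite andbT; case: ifP => [/hF[ha hi]|_]; try exact: O0.
- exact: ha.
- exact: hi.
Qed.

Lemma theta_span h : global_function h ->
  exists (s : seq (int * {ffun 'I_N -> int})) (c : _ -> K),
    [/\ uniq s, all (@index_set k N.+1 m) s
      & h = \sum_(j <- s) iota (c j) * theta_fun j].
Proof.
move=> /global_functionE[Q [Eh hQ]].
pose s := [seq (e%:Z, box_exponent b) | b <- enum {: box}, e <- index_iota 0 (size (Q b))].
pose c (j : int * {ffun 'I_N -> int}) := (Q (exponent_box j.2))`_(`|j.1|%N).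
exists s, c; split.
- apply: allpairs_uniq_dep => [|b _|]; [exact: enum_uniq|exact: iota_uniq|].
  move=> [b e] [b' e'] _ _ /= [].
  by move=> -> /(can_inj box_exponentK) ->.
- apply/allP => _ /allpairsPdep[b [e [_ he ->]]]; apply/index_setE.
  exists e, b; split=> //; move: he; rewrite mem_index_iota /= => he.
  case: (hQ b) => [Q0|]; first by move: he; rewrite Q0 size_poly0.
  apply: leq_trans; rewrite !leq_add2r -ltnS prednK //.
  exact: leq_ltn_trans he.
rewrite Eh /s big_allpairs_dep big_enum /= mulr_suml; apply: eq_bigr => b _.
rewrite big_mkord /evalx horner_coef size_map_poly mulr_sumr mulr_suml.
apply: eq_bigr => e _.
rewrite theta_fun_box /c /= box_exponentK ?absz_nat coef_map.
by field; exact: ymon_neq0.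
Qed.

Lemma theta_basis :
  is_Kbasis iota (global_mdiff X iota xi d tens) (@index_set k N.+1 m)
    (@theta L N.+1 m xi Omega d T tens).
Proof.
split=> [s c us hs|w]; first exact: theta_free.
split=> [gw|[s [c [us hs ->]]]].
  have [h Ew] := proj1 tdx_generated w.
  have /theta_span[s [c [us hs Eh]]] : global_function h.
    by apply/global_mdiffE; rewrite -Ew.
  by exists s, c; split=> //; rewrite combinationE -Eh.
rewrite combinationE; apply/global_mdiffE; apply: global_function_sum => j js.
by apply: theta_global; apply: (allP hs).
Qed.

End Differentials.
End Projections.
End Fermat.

Theorem theorem1 (K : closedFieldType) (k n : nat) (lam : nat -> K)
  (hk : (2 <= k)%N) (hn : (2 <= n)%N) (hkn : (1 < (k - 1) * (n - 1))%N)
  (hchar : forall p : nat, p \in [pchar K] -> ~~ (p %| k)%N)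
  (hlam1 : lam 1%N = 1)
  (hlam : forall i : nat, (2 <= i <= n - 1)%N -> lam i != 0 /\ lam i != 1)
  (hlam_inj : forall i j : nat, (2 <= i <= n - 1)%N -> (2 <= j <= n - 1)%N ->
     lam i = lam j -> i = j)
  (L : fieldType) (iota : {rmorphism K -> L}) (xi : 'I_n.+1 -> L)
  (hL : is_function_field (fermat_curve k lam) iota xi)
  (Omega : lmodType L) (d : L -> Omega) (hOmega : is_kaehler iota d)
  (m : nat) (hm : (1 <= m)%N)
  (T : lmodType L) (tens : {ffun 'I_m -> Omega} -> T)
  (hT : is_tensor_power tens) :
  is_Kbasis iota (global_mdiff (fermat_curve k lam) iota xi d tens)
    (@index_set k n m) (theta xi d tens).
Proof.
case: n hn hkn hlam hlam_inj xi hL => // N _ _ hlam hlam_inj xi hL.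
rewrite subSS subn0 in hlam hlam_inj.
have k_neq0 : k%:R != 0 :> K.
  apply/negP => k0; have [p pK] := natf0_pchar (ltnW hk) k0.
  by have := hchar p pK; rewrite (dvdn_pcharf pK) k0.
pose mu (j : 'I_N) := lam j.+1.
have mu_cases (j : 'I_N) : j = 0%N :> nat \/ (2 <= j.+1 <= N)%N.
  by case: (posnP j) => [->|j0]; [left | right; rewrite ltnS j0 ltn_ord].
have mu_neq0 j : mu j != 0.
  rewrite /mu; case: (mu_cases j) => [->|/hlam[] //].
  by rewrite hlam1 oner_neq0.
have mu_inj : injective mu.
  move=> j l; rewrite /mu => E; apply: val_inj => /=.
  case: (mu_cases j) (mu_cases l) => [j0|hj] [l0|hl].
  - by rewrite j0 l0.
  - by have [_] := hlam _ hl; rewrite -E j0 hlam1 eqxx.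
  - by have [_] := hlam _ hj; rewrite E l0 hlam1 eqxx.
  - by case: (hlam_inj _ _ hj hl E).
have XE P : fermat_curve k lam P <-> (exists i, P i != 0) /\
    forall j : 'I_N, mu j * P i0 ^+ k + P i1 ^+ k + P (iy j) ^+ k = 0.
  have e0 : inord 0 = i0 :> 'I_N.+2 by apply: val_inj; rewrite /= inordK.
  rewrite /fermat_curve subSS subn0 e0 inord1E; split=> -[nz h]; (split; first exact: nz).
    by move=> j; have := h j.+1 (ltn_ord j); rewrite inordyE.
  move=> [//|i] /andP[_ hi]; have := h (Ordinal hi).
  by rewrite -inordyE.
have [zeta hzeta] := primitive_root hk k_neq0.
have [sg hsg] := galois_exists hk XE hL hzeta.
exact: (theta_basis hk k_neq0 mu_neq0 mu_inj XE hL hzeta hsg hOmega hT hm).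
Qed.
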